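(* Let $K \subset \overline{\mathbb{Q}}$ be a number field of odd degree $[K:\mathbb{Q}]$ such that $\operatorname{rank}_{\mathbb{Z}} E_1(K) = \operatorname{rank}_{\mathbb{Z}} E_2(K) = 0$, where $E_1\colon y^2 = x^3+4x$ and $E_2\colon y^2 = x^3-4x$. Then $\Gamma_2(F_4,K)=\Gamma_2(F_4,\mathbb{Q})$.
   Context: $F_4$ denotes the Fermat quartic, the projective plane curve $X^4+Y^4=Z^4$ over $\mathbb{Q}$. For a number field $K$, $\Gamma_2(F_4,K)=\bigcup\{F_4(L) : K\subset L\subset \overline{\mathbb{Q}},\ [L:K]=2\}$, the set of $K$-quadratic points of $F_4$. *)

(* Defs.v *)
From HB Require Import structures.
From mathcomp Require Import all_boot all_order all_algebra all_field.
From mathcomp Require Import boolp classical_sets.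

Set Implicit Arguments.
Unset Strict Implicit.
Unset Printing Implicit Defensive.

Import Order.TTheory GRing.Theory Num.Theory.

Local Open Scope ring_scope.
Local Open Scope classical_set_scope.

(* [None] is the point at infinity. *)
Definition ec_point (F : fieldType) := option (F * F).

Definition on_ec (F : fieldType) (a b : F) (P : ec_point F) : bool :=
  if P is Some (x, y) then y ^+ 2 == x ^+ 3 + a * x + b else true.

Definition ec_opp (F : fieldType) (P : ec_point F) : ec_point F :=
  if P is Some (x, y) then Some (x, - y) else None.

(* Chord-and-tangent law on y^2 = x^3 + a x + b; [b] does not occur in the
   formulas. Only meaningful for points of the curve, in characteristic not 2. *)
Definition ec_add (F : fieldType) (a : F) (P Q : ec_point F) : ec_point F :=
  match P, Q with
  | None, _ => Q
  | _, None => P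
  | Some (x1, y1), Some (x2, y2) =>
      if (x1 == x2) && (y1 == - y2) then None else
      let l := if x1 == x2 then (3 * x1 ^+ 2 + a) / (2 * y1)
               else (y2 - y1) / (x2 - x1) in
      let x3 := l ^+ 2 - x1 - x2 in
      Some (x3, l * (x1 - x3) - y1)
  end.

Definition ec_mulz (F : fieldType) (a : F) (P : ec_point F) (m : int) :
    ec_point F :=
  match m with
  | Posz n => iter n (ec_add a P) None
  | Negz n => ec_opp (iter n.+1 (ec_add a P) None)
  end.

Definition ec_independent (F : fieldType) (a : F) (n : nat)
    (P : 'I_n -> ec_point F) : Prop :=
  forall c : 'I_n -> int,
    \big[ec_add a/None]_(i < n) ec_mulz a (P i) (c i) = None ->
    forall i, c i = 0.

(* The group of F-points of y^2 = x^3 + a x + b has Z-rank [r]: [r] is the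
   largest size of a Z-linearly independent family of points. *)
Definition ec_has_rank (F : fieldType) (a b : F) (r : nat) : Prop :=
  (exists P : 'I_r -> ec_point F,
     (forall i, on_ec a b (P i)) /\ ec_independent a P) /\
  (forall (n : nat) (P : 'I_n -> ec_point F),
     (forall i, on_ec a b (P i)) -> ec_independent a P -> (n <= r)%N).

(* Points of the projective plane over algC are the lines of algC^3. *)
Definition F4 (L : fieldType) (j : {rmorphism L -> algC}) :
    set {vspace 'rV[algC]_3} :=
  [set P | exists v : 'rV[L]_3,
     [/\ v != 0,
         v 0 0 ^+ 4 + v 0 1 ^+ 4 = v 0 2%:R ^+ 4 &
         P = <[map_mx j v]>%VS]].

(* A subfield of algC is given as a field with an embedding into algC; an
   intermediate field K <= L <= algC is a K-algebra L whose embedding extends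
   that of K. *)
Definition Gamma2 (K : fieldType) (iota : {rmorphism K -> algC}) :
    set {vspace 'rV[algC]_3} :=
  [set P | exists (L : fieldExtType K) (j : {rmorphism L -> algC}),
     [/\ forall c : K, j c%:A = iota c,
         \dim {:L} = 2%N &
         F4 j P]].

(* Main.v *)
(* An affine point (x, y) over K(d), [K(d) : K] = 2, either has slope t = y/x in
   K, or yields a point (w, t) = (1/x^2, y/x) of the genus 1 curve w^2 = 1 + t^4
   with t outside K. In the second case the parabola w = 1 + b t + c t^2 over K
   through this point, its conjugate and (0, 1) has one more intersection with
   the curve, which must be a known K-point. This leaves the points with xy = 0
   and those with x + y = 1, xy = 2 (up to signs), defined over Q(sqrt(-7)).

   The K-points used are those of genus 1 quartics mapping to E1 or E2, so they
   come from torsion points. E1 and E2 map homomorphically to the quartics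
   u^2 = 1 - a^2 t^4 (a = 1, 2). A torsion point of the quartic that is periodic
   under doubling has V = u - 1 equal to 0 or 2-adically a unit, and V + 2 is
   twice a square since the point is a double; as [K : Q] is odd, the norm of
   V + 2 excludes the unit case. Hence all torsion is 2-primary, and it is small
   because -1, 2 and -2 are not squares in K. *)
Require Import Defs.
From HB Require Import structures.
From mathcomp Require Import all_boot all_order all_algebra all_field.
From mathcomp Require Import boolp classical_sets.
From mathcomp Require Import ring zify.

Set Implicit Arguments.
Unset Strict Implicit.
Unset Printing Implicit Defensive.

Import Order.TTheory GRing.Theory Num.Theory.

Local Open Scope ring_scope.

(** * The group law of a Jacobi quartic *)

Section JacobiQuartic.
Variable F : fieldType.
Hypothesis not_sqrN1 : forall z : F, z ^+ 2 != -1.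

Lemma sum_sqr_neq0 (z w : F) : w != 0 -> w ^+ 2 + z ^+ 2 != 0.
Proof.
move=> w0; apply: contra (not_sqrN1 (z / w)) => /eqP h; apply/eqP.
apply: (mulfI (expf_neq0 2 w0)); rewrite expr_div_n mulrCA mulfV ?expf_neq0 //.
by rewrite mulr1 mulrN1 -[RHS]addr0 -h addKr.
Qed.

(* Euler's addition law on the quartic u^2 = 1 - a^2 t^4, for (t, u); it has no
   exceptional cases because -1 is not a square. *)
Definition jq_add (a : F) (P Q : F * F) : F * F :=
  let: (t1, u1) := P in let: (t2, u2) := Q in
  ((t1 * u2 + t2 * u1) / (1 + (a * t1 * t2) ^+ 2),
   ((1 - (a * t1 * t2) ^+ 2) * (u1 * u2)
      - 2 * a ^+ 2 * t1 * t2 * (t1 ^+ 2 + t2 ^+ 2))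
     / (1 + (a * t1 * t2) ^+ 2) ^+ 2).

Definition on_jq (a : F) (P : F * F) := P.2 ^+ 2 = 1 - a ^+ 2 * P.1 ^+ 4.

Lemma add1_sqr_neq0 (z : F) : 1 + z ^+ 2 != 0.
Proof. by rewrite -[1](expr1n _ 2) sum_sqr_neq0 ?oner_eq0. Qed.

Lemma on_jq_add a P Q : on_jq a P -> on_jq a Q -> on_jq a (jq_add a P Q).
Proof.
case: P Q => [t1 u1] [t2 u2]; rewrite /on_jq /= => h1 h2.
by field: h1 h2; apply: add1_sqr_neq0.
Qed.

(** Every denominator is a sum of two squares, one of them nonzero, so associativity is an identity
    of rational functions modulo the three curve equations. *)
Lemma jq_addA a P Q R : on_jq a P -> on_jq a Q -> on_jq a R ->
  jq_add a P (jq_add a Q R) = jq_add a (jq_add a P Q) R.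
Proof.
case: P Q R => [t1 u1] [t2 u2] [t3 u3]; rewrite /on_jq /= => h1 h2 h3.
by congr (_, _); field: h1 h2 h3; rewrite !sum_sqr_neq0 ?add1_sqr_neq0.
Qed.

Lemma jq_add0l a P : jq_add a (0, 1) P = P.
Proof. by case: P => t u; congr (_, _); field; apply: oner_neq0. Qed.

Lemma jq_add0r a P : jq_add a P (0, 1) = P.
Proof. by case: P => t u; congr (_, _); field; apply: oner_neq0. Qed.

Lemma on_jq0 a : on_jq a (0, 1).
Proof. by rewrite /on_jq /= expr0n mulr0 subr0 expr1n. Qed.

Definition jq_mul a n P := iter n (jq_add a P) (0, 1).

Lemma on_jq_mul a n P : on_jq a P -> on_jq a (jq_mul a n P).
Proof. by move=> hP; elim: n => [|n IH];
  [apply: on_jq0 | apply: on_jq_add]. Qed.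

Lemma jq_mulD a m n P : on_jq a P ->
  jq_mul a (m + n) P = jq_add a (jq_mul a m P) (jq_mul a n P).
Proof.
move=> hP; elim: m => [|m IH]; first by rewrite jq_add0l.
by rewrite addSn /jq_mul !iterS -/(jq_mul a _ P) IH jq_addA //;
  apply: on_jq_mul.
Qed.

Definition jq_dbl a P := jq_add a P P.

Lemma on_jq_dbl a n P : on_jq a P -> on_jq a (iter n (jq_dbl a) P).
Proof. by move=> hP; elim: n => //= n IH; apply: on_jq_add. Qed.

Lemma iter_jq_dbl a n P : on_jq a P -> iter n (jq_dbl a) P = jq_mul a (2 ^ n) P.
Proof.
move=> hP; elim: n => [|n IH]; first by rewrite /jq_mul /= jq_add0r.
by rewrite iterS IH expnS mul2n -addnn jq_mulD.
Qed.

Lemma jq_mul_modn a n k P : on_jq a P -> jq_mul a n P = (0, 1) ->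
  jq_mul a (k %% n) P = jq_mul a k P.
Proof.
move=> hP nP; rewrite {2}(divn_eq k n) jq_mulD //.
suff -> : jq_mul a (k %/ n * n) P = (0, 1) by rewrite jq_add0l.
by elim: (k %/ n)%N => [|q IH] //; rewrite mulSn jq_mulD // nP IH jq_add0l.
Qed.

(** Pigeonhole: the powers of 2 repeat modulo the order n + 1, so a torsion point is eventually
    periodic under doubling. *)
Lemma jq_dbl_periodic a n P : on_jq a P -> jq_mul a n.+1 P = (0, 1) ->
  exists r m, iter (r + m.+1) (jq_dbl a) P = iter r (jq_dbl a) P.
Proof.
move=> hP nP; pose f (i : 'I_n.+2) : 'I_n.+1 := inord (2 ^ i %% n.+1).
have : ~~ injectiveb f.
  by apply/negP => /injectiveP /leq_card; rewrite !card_ord ltnn.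
case/injectivePn => i [j neq_ij] /(congr1 val);
  rewrite /= !inordK ?ltn_pmod // => e.
have {}e : iter i (jq_dbl a) P = iter j (jq_dbl a) P.
  by rewrite !iter_jq_dbl // -(jq_mul_modn _ hP nP) e jq_mul_modn.
have : (i < j)%N || (j < i)%N by rewrite -neq_ltn.
case/orP => lt; [exists i, (j - i.+1)%N|exists j, (i - j.+1)%N];
  by rewrite addnS -addSn subnKC.
Qed.

End JacobiQuartic.

(** * Homomorphisms from E1 and E2 to the Jacobi quartics *)

Section EllipticToQuartic.
Variable F : fieldType.
Hypothesis not_sqrN1 : forall z : F, z ^+ 2 != -1.
Hypothesis two_neq0 : (2 : F) != 0.

(* [l] is the slope of the chord or tangent. *)
Lemma ec_add_morph (a : F) (T : Type) (phi : ec_point F -> T)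
  (op : T -> T -> T) :
  (forall P, op (phi None) (phi P) = phi P) ->
  (forall P, op (phi P) (phi None) = phi P) ->
  (forall x y, y ^+ 2 = x ^+ 3 + a * x ->
     op (phi (Some (x, - y))) (phi (Some (x, y))) = phi None) ->
  (forall x y l, y ^+ 2 = x ^+ 3 + a * x -> y != 0 ->
     l = (3 * x ^+ 2 + a) / (2 * y) ->
     op (phi (Some (x, y))) (phi (Some (x, y)))
       = phi (Some (l ^+ 2 - x - x, l * (x - (l ^+ 2 - x - x)) - y))) ->
  (forall x1 y1 x2 y2 l,
     y1 ^+ 2 = x1 ^+ 3 + a * x1 -> y2 ^+ 2 = x2 ^+ 3 + a * x2 ->
     x2 - x1 != 0 -> l = (y2 - y1) / (x2 - x1) ->
     op (phi (Some (x1, y1))) (phi (Some (x2, y2)))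
       = phi (Some (l ^+ 2 - x1 - x2, l * (x1 - (l ^+ 2 - x1 - x2)) - y1))) ->
  forall P Q, on_ec a 0 P -> on_ec a 0 Q ->
    phi (ec_add a P Q) = op (phi P) (phi Q).
Proof.
move=> h0l h0r hopp hdbl hchord [[x1 y1]|] [[x2 y2]|] //=.
rewrite !addr0 => /eqP h1 /eqP h2.
case: ifP => [/andP[/eqP e1 /eqP e2]|]; first by subst x2 y1; rewrite hopp.
case: (eqVneq x1 x2) => [e1 | e1] /= e2; last first.
  by rewrite (hchord _ _ _ _ _ h1 h2 _ erefl) // subr_eq0 eq_sym.
subst x2; have : (y1 - y2) * (y1 + y2) = 0 by rewrite -subr_sqr h1 h2 subrr.
move/eqP; rewrite mulf_eq0 subr_eq0 addr_eq0 e2 orbF => /eqP e; subst y2.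
by rewrite (hdbl _ _ _ h1 _ erefl) //; apply: contraFneq e2 => ->;
  rewrite oppr0.
Qed.

Lemma on_ec_add (a : F) P Q :
  on_ec a 0 P -> on_ec a 0 Q -> on_ec a 0 (ec_add a P Q).
Proof.
move=> hP hQ; suff -> : on_ec a 0 (ec_add a P Q) = on_ec a 0 P && on_ec a 0 Q.
  by rewrite hP hQ.
(* Membership in the curve is itself treated as a morphism, into the booleans under conjunction. *)
apply: (@ec_add_morph a bool (on_ec a 0) andb) => //.
- by move=> P'; rewrite andbT.
- by move=> x y h /=; rewrite !addr0 sqrrN h eqxx.
- move=> x y l h y0 ->; rewrite /= !addr0 h !eqxx; symmetry; apply/eqP.
  by field: h; rewrite two_neq0 y0.
- move=> x1 y1 x2 y2 l h1 h2 e ->; rewrite /= !addr0 h1 h2 !eqxx.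
  by symmetry; apply/eqP; field: h1 h2.
Qed.

Lemma sqr_add4_neq0 (z : F) : z ^+ 2 + 4 != 0.
Proof. by rewrite (_ : 4 = 2 ^+ 2) 1?addrC ?sum_sqr_neq0 // -natrX. Qed.

Lemma sqr_add4M_neq0 (z w : F) : w != 0 -> z ^+ 2 + 4 * w ^+ 4 != 0.
Proof.
move=> w0; have -> : z ^+ 2 + 4 * w ^+ 4 = (2 * w ^+ 2) ^+ 2 + z ^+ 2 by ring.
by rewrite sum_sqr_neq0 // mulf_neq0 // expf_neq0.
Qed.

Lemma sqr_add64M_neq0 (z w : F) : w != 0 -> z ^+ 2 + 4 * (16 * w ^+ 4) != 0.
Proof.
move=> w0; rewrite (_ : 16 * w ^+ 4 = (2 * w) ^+ 4); last by ring.
by rewrite sqr_add4M_neq0 // mulf_neq0.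
Qed.

(** Inverse of the birational map (t, u) |-> (2(1+u)/t^2, 4(1+u)/t^3) from u^2 = 1 - t^4 to E1. *)
Definition jq_of_E1 (P : ec_point F) : F * F :=
  if P is Some (x, y) then (2 * y / (x ^+ 2 + 4), (x ^+ 2 - 4) / (x ^+ 2 + 4))
  else (0, 1).

(* The 2-isogeny (x, y) |-> (y^2/x^2, y (x^2+4)/x^2) from y^2 = x^3 - 4x to
   y^2 = x^3 + 16x, followed by the analogue of [jq_of_E1]. *)
Definition jq_of_E2 (P : ec_point F) : F * F :=
  if P is Some (x, y) then
    (2 * y / (x ^+ 2 + 4), (x ^+ 4 - 24 * x ^+ 2 + 16) / (x ^+ 2 + 4) ^+ 2)
  else (0, 1).

Lemma jq_of_E1_add P Q : on_ec 4 0 P -> on_ec 4 0 Q ->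
  jq_of_E1 (ec_add 4 P Q) = jq_add 1 (jq_of_E1 P) (jq_of_E1 Q).
Proof.
apply: ec_add_morph => [?|?|x y h|x y l h y0 ->|x1 y1 x2 y2 l h1 h2 e ->].
- exact: jq_add0l.
- exact: jq_add0r.
- by congr (_, _); field: h; rewrite ?sum_sqr_neq0 ?mulf_neq0 ?sqr_add4_neq0.
- by congr (_, _); field: h;
    rewrite y0 two_neq0 sqr_add64M_neq0 // sum_sqr_neq0 ?mulf_neq0
      ?sqr_add4_neq0.
- by congr (_, _); field: h1 h2;
    rewrite e sqr_add4M_neq0 // sum_sqr_neq0 ?mulf_neq0 ?sqr_add4_neq0.
Qed.

Lemma jq_of_E2_add P Q : on_ec (-4) 0 P -> on_ec (-4) 0 Q ->
  jq_of_E2 (ec_add (-4) P Q) = jq_add 2 (jq_of_E2 P) (jq_of_E2 Q).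
Proof.
apply: ec_add_morph => [?|?|x y h|x y l h y0 ->|x1 y1 x2 y2 l h1 h2 e ->].
- exact: jq_add0l.
- exact: jq_add0r.
- by congr (_, _); field: h; rewrite ?sum_sqr_neq0 ?mulf_neq0 ?sqr_add4_neq0.
- by congr (_, _); field: h;
    rewrite y0 two_neq0 sqr_add64M_neq0 // sum_sqr_neq0 ?mulf_neq0
      ?sqr_add4_neq0.
- by congr (_, _); field: h1 h2;
    rewrite e sqr_add4M_neq0 // sum_sqr_neq0 ?mulf_neq0 ?sqr_add4_neq0.
Qed.

Lemma on_jq_of_E1 P : on_ec 4 0 P -> on_jq 1 (jq_of_E1 P).
Proof.
case: P => [[x y]|_]; last exact: on_jq0.
by rewrite /on_jq /= addr0 => /eqP h; field: h; apply: sqr_add4_neq0.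
Qed.

Lemma on_jq_of_E2 P : on_ec (-4) 0 P -> on_jq 2 (jq_of_E2 P).
Proof.
case: P => [[x y]|_]; last exact: on_jq0.
by rewrite /on_jq /= addr0 => /eqP h; field: h; apply: sqr_add4_neq0.
Qed.

End EllipticToQuartic.

(** * Number fields of odd degree *)

(** After clearing the denominator of [c], the 2-adic valuation is even on the left and odd on the
    right. *)
Lemma odd_mul_sqr_neq (d : nat) (N : int) (c : rat) :
  odd d -> odd `|N| -> N%:~R != 2 ^+ d * c ^+ 2.
Proof.
move=> oddd oddN; apply/eqP => h.
have e : (N * denq c ^+ 2 = 2 ^+ d * numq c ^+ 2)%R.
  apply: (@intr_inj rat).
  by rewrite !(rmorphM, rmorphXn) /= h -mulrA -exprMn -numqE.
have {}e : (`|N| * `|denq c| ^ 2 = 2 ^ d * `|numq c| ^ 2)%N.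
  by rewrite -!abszX -abszM e abszM !abszX.
have N0 : (0 < `|N|)%N by case: `|N|%N oddN.
have D0 : (0 < `|denq c|)%N by rewrite absz_gt0.
have n0 : (0 < `|numq c|)%N.
  rewrite lt0n; apply/eqP => z0; move/eqP: e.
  by rewrite z0 exp0n // muln0 muln_eq0 expn_eq0 !gtn_eqF.
have := congr1 (logn 2) e;
  rewrite !lognM ?expn_gt0 ?N0 ?D0 ?n0 // !lognX (@logn_prime 2 2) // muln1.
rewrite lognE /= N0 dvdn2 oddN /= add0n => /(congr1 odd).
by rewrite !oddD oddd !addbb.
Qed.

Section OddDegree.
Variable K : fieldExtType rat.
Hypothesis odd_deg : odd (\dim {:K}).

Lemma odd_dim_subfield (F : {subfield K}) : odd (\dim F).
Proof. exact: dvdn_odd (field_dimS (subvf F : (F <= {:K}%AS)%VS)) odd_deg. Qed.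

(** The degree of q over F is at most 2, and it is odd because it divides the odd degree of F(q). *)
Lemma mem_of_sqr_mem (F : {subfield K}) (q : K) : q ^+ 2 \in F -> q \in F.
Proof.
move=> Fq2.
have adj_odd : odd (adjoin_degree F q).
  by have := odd_dim_subfield <<F; q>>; rewrite dim_Fadjoin oddM => /andP[].
have adj_le2 : (adjoin_degree F q <= 2)%N.
  rewrite -ltnS -size_minPoly -[3%N](size_XnsubC (q ^+ 2) (ltn0Sn 1)).
  apply: dvdp_leq; first by rewrite -size_poly_eq0 size_XnsubC.
  by apply: minPoly_dvdp;
    rewrite ?rpredB ?rpredX ?polyOverX ?polyOverC // /root !hornerE subrr.
suff /eqP : adjoin_degree F q = 1%N by rewrite adjoin_deg_eq1.
by case: (adjoin_degree F q) adj_odd adj_le2 => [|[|[]]].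
Qed.

Lemma rat_sqrt (q : K) (c : rat) : q ^+ 2 = c%:A ->
  exists2 b : rat, q = b%:A & c = b ^+ 2.
Proof.
move=> h; have : q \in 1%AS by apply: mem_of_sqr_mem; rewrite h memvZ ?mem1v.
move=> /vlineP[b e]; exists b => //; apply: (fmorph_inj (in_alg K)).
by rewrite /= -h e -[RHS]/(in_alg K (b ^+ 2)) rmorphXn.
Qed.

Lemma sqr_neq_small (q : K) : (q ^+ 2 != 2) * (q ^+ 2 != -2) * (q ^+ 2 != -1).
Proof.
have E (n : int) : n%:~R = n%:~R%:A :> K by rewrite -in_algE rmorph_int.
have N (n : int) : n < 0 -> q ^+ 2 != n%:~R.
  move=> n0; apply/eqP; rewrite E => /rat_sqrt[b _ h].
  by have := sqr_ge0 b; rewrite -h ler0z leNgt n0.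
do ![split]; [|exact: (N (- 2%:Z))|exact: (N (- 1%:Z))].
apply/eqP; rewrite -[2]/(2%:~R) E => /rat_sqrt[b _ h].
have b0 : b != 0 by apply: contra_eq_neq h => ->; rewrite expr0n.
(* From b^2 = 2 follows 1 = 2 (1/b)^2. *)
have /eqP[] := @odd_mul_sqr_neq 1 1 b^-1 isT isT.
by rewrite expr1 exprVn -h.
Qed.

Lemma rat_minpoly (x : K) : exists p : {poly rat},
  [/\ p \is monic, root (map_poly (in_alg K) p) x, size p = (\dim <<1; x>>).+1 &
      forall q, root (map_poly (in_alg K) q) x -> p %| q].
Proof.
have /polyOver1P[p Dp] := minPolyOver 1 x; exists p.
have e : size p = (\dim <<1; x>>).+1.
  by rewrite -(size_map_poly (in_alg K)) -Dp size_minPoly dim_Fadjoin dimv1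
    muln1.
split=> //; first by rewrite -(map_monic (in_alg K)) -Dp monic_minPoly.
  by rewrite -Dp root_minPoly.
by move=> q qx; rewrite -(dvdp_map (in_alg K)) -Dp minPoly_dvdp ?alg_polyOver.
Qed.

(* If e and o are the even and odd parts of the minimal polynomial of q, then
   that of q^2 is Y o(Y)^2 - e(Y)^2: the norm of a square is a square. *)
Lemma minpoly_sqr (q : K) : exists m : {poly rat},
  [/\ m \is monic, root (map_poly (in_alg K) m) (q ^+ 2), odd (size m).-1,
      forall r, root (map_poly (in_alg K) r) (q ^+ 2) -> m %| r &
      exists c, m`_0 = - c ^+ 2].
Proof.
have [p [pmon pq sp pmin]] := rat_minpoly q.
have [m [mmon mx sm mmin]] := rat_minpoly (q ^+ 2).
exists m; split => //; first by rewrite sm odd_dim_subfield.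
(* Q(q^2) = Q(q), since q lies in Q(q^2) by [mem_of_sqr_mem]. *)
have es : size m = size p.
  rewrite sm sp; congr (\dim _).+1; apply: subv_anti; apply/andP; split.
    by apply/FadjoinP; split; rewrite ?sub1v // rpredX // memv_adjoin.
  apply/FadjoinP; split; rewrite ?sub1v //.
  by apply: (@mem_of_sqr_mem <<1; q ^+ 2>>%AS); apply: memv_adjoin.
pose e := even_poly p; pose o := odd_poly p.
pose S := 'X * o ^+ 2 - e ^+ 2.
(* As p has odd degree, its leading coefficient belongs to [o], and ['X * o ^+ 2] carries the
   leading term of [S]. *)
have osp : ~~ odd (size p) by rewrite sp /= odd_dim_subfield.
have p0 : (0 < size p)%N by rewrite sp.
have so : size o = (size p)./2 by rewrite size_odd_poly_eq.
have o0 : o != 0 by rewrite -size_poly_eq0 so; case: (size p) p0 osp => [|[]].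
have sXo : size ('X * o ^+ 2) = size p.
  have o20 := expf_neq0 2 o0;
    rewrite mulrC size_mulX // polySpred // size_exp so.
  by move: p0 osp; clear; lia.
have se : (size (e ^+ 2)%R < size p)%N.
  have := size_even_poly p; have := size_exp e 2; rewrite uphalf_half -/e.
  move: p0 osp; clear; move: (size (e ^+ 2)) (size e) (size p) => a b k; lia.
have monS : S \is monic.
  rewrite monicE lead_coefDl ?size_polyN ?sXo // mulrC lead_coefMX
    lead_coef_exp.
  have -> : lead_coef o = 1; last by rewrite expr1n.
  rewrite lead_coefE so coef_odd_poly -(monicP pmon) lead_coefE.
  by congr (_ `_ _); move: p0 osp; clear; lia.
have sS : size S = size p by rewrite size_polyDl ?size_polyN ?sXo.
have S0 : S`_0 = - (p`_0) ^+ 2.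
  by rewrite coefB coefXM sub0r -!horner_coef0 horner_exp !horner_coef0
    coef_even_poly.
(* From p(q) = e(q^2) + q o(q^2) = 0 one gets q^2 o(q^2)^2 = e(q^2)^2. *)
have : m %| S.
  apply: mmin; rewrite /root rmorphB /= rmorphM /= !rmorphXn /= map_polyX
    !hornerE.
  move: pq; rewrite -{1}[p]poly_even_odd rmorphD rmorphM /= !map_comp_poly
    !map_polyXn map_polyX.
  rewrite /root !hornerE !horner_comp hornerXn -/e -/o addr_eq0 => /eqP ->.
  by apply/eqP; ring.
move=> /dvdp_size_eqp; rewrite es sS eqxx => /esym h.
have -> : m = S by apply/eqP; rewrite -eqp_monic.
by exists p`_0.
Qed.

(* The norm of a root of R is a 2-adic unit, whereas that of 2 q^2 has odd
   2-adic valuation. *)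
Lemma odd_unit_not_twice_sqr (R : {poly int}) (q : K) :
  R \is monic -> odd `|R`_0| -> ~~ root (map_poly intr R) (2 * q ^+ 2).
Proof.
move=> Rmon R0; apply/negP => Rq.
have [m [mmon mq modd mmin [c m0]]] := minpoly_sqr q.
set d := (size m).-1 in modd.
have sm : size m = d.+1 by rewrite prednK // size_poly_gt0 monic_neq0.
(* [M] vanishes at 2 q^2 and will divide [R]; it has the constant term of [m] and leading
   coefficient 2^-d. *)
pose M := m \Po (2^-1 *: 'X).
have M0 : M`_0 = - c ^+ 2.
  by rewrite -horner_coef0 horner_comp !hornerE horner_coef0.
have lM : lead_coef M = 2 ^- d.
  by rewrite lead_coef_comp ?size_scale ?size_polyX // (monicP mmon) lead_coefZ
    lead_coefX mul1r mulr1 exprVn.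
have : M %| map_poly intr R.
  have -> : map_poly intr R = (map_poly intr R \Po (2 *: 'X)) \Po (2^-1 *: 'X)
    :> {poly rat}.
    by rewrite -comp_polyA comp_polyZ comp_polyX scalerA divff // scale1r
      comp_polyXr.
  apply: dvdp_comp_poly; apply: mmin.
  rewrite /root map_comp_poly map_polyZ map_polyX horner_comp !hornerE.
  rewrite -map_poly_comp (eq_map_poly (_ : _ =1 intr)) => [|n];
    last exact: rmorph_int.
  by move: Rq; rewrite rmorph_nat expr2 mulrA.
(* By Gauss's lemma [M] is a rational multiple of an integral factor [p1] of [R]. As [R] is monic
   with odd constant term, [p1] has leading coefficient 1 or -1 and odd constant term. *)
move=> dvdM; have [p1 [a a0 Mp1] [r Rr]] := dvdpP_rat_int dvdM.
have l2 : lead_coef p1 ^+ 2 = 1.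
  move/eqP: Rmon; rewrite Rr lead_coefM => /(congr1 absz)/eqP;
    rewrite abszM muln_eq1.
  by case/andP=> /eqP l1 _; rewrite -[LHS]gez0_abs ?sqr_ge0 // abszX l1.
have p10 : odd `|p1`_0|.
  by move: R0; rewrite Rr -!horner_coef0 hornerM abszM oddM => /andP[].
have oddN : odd `|- (lead_coef p1 * p1`_0)|.
  by rewrite abszN abszM oddM p10; have := congr1 (odd \o absz) l2;
    rewrite /= abszX oddX => /= ->.
have h0 : - c ^+ 2 = a * (p1`_0)%:~R by rewrite -M0 Mp1 coefZ coef_map.
have hl : 1 = 2 ^+ d * (a * (lead_coef p1)%:~R).
  have -> : a * (lead_coef p1)%:~R = lead_coef M.
    by rewrite Mp1 lead_coefZ lead_coef_map_inj //; apply: intr_inj.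
  by rewrite lM divff // expf_neq0.
(* Eliminating [a] from the equations for the two extreme coefficients gives - lead(p1) p1(0) = 2^d
   c^2, with odd left side and odd d. *)
move/eqP: (odd_mul_sqr_neq c modd oddN); apply.
have hl2 : (lead_coef p1)%:~R ^+ 2 = 1 :> rat by rewrite -rmorphXn l2.
rewrite rmorphN rmorphM /= -[LHS]mul1r [in X in X * _]hl -[c ^+ 2]opprK h0.
by ring: hl2.
Qed.

(* The effect of doubling on V = u - 1, for a point (t, u) of the quartic. *)
Definition dbl_map (V : K) := 8 * V * (V + 2) / (1 - 2 * V - V ^+ 2) ^+ 2.

(* The (m+1)-st iterate of [dbl_map] is V C(V) / B(V), where (C, B) is
   [dbl_poly m]; a periodic V <> 0 is thus a root of B - C, which is monic with
   odd constant term. *)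
Definition dbl_poly_step (CB : {poly int} * {poly int}) :=
  let: (C, B) := CB in
  (8%:P * C * ('X * C + 2%:P * B) * B ^+ 2,
   (B ^+ 2 - 2%:P * 'X * C * B - 'X ^+ 2 * C ^+ 2) ^+ 2).

Definition dbl_poly m := iter m dbl_poly_step
  (8%:P * ('X + 2%:P), (1 - 2%:P * 'X - 'X^2) ^+ 2).

(** A degree gap of 2, rather than 1, keeps ['X * C] of lower degree than [B], which the recursion
    needs. *)
Definition dbl_poly_invariant (CB : {poly int} * {poly int}) :=
  [/\ CB.2 \is monic, (size CB.1 + 2 <= size CB.2)%N,
    ~~ odd `|CB.1`_0| & odd `|CB.2`_0|].

Lemma dbl_poly_invariantP m : dbl_poly_invariant (dbl_poly m).
Proof.
elim: m => [|m]; rewrite /dbl_poly.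
  have -> : (1 - 2%:P * 'X - 'X^2) ^+ 2 = ('X^2 + (2%:P * 'X + (-1)%:P)) ^+ 2
    :> {poly int}.
    by rewrite rmorphN /=; ring.
  have sL : (size (2%:P * 'X + (-1)%:P : {poly int})%R < size
    ('X^2 : {poly int}))%N.
    by rewrite size_MXaddC size_polyC size_polyXn polyC_eq0.
  have Qmon : 'X^2 + (2%:P * 'X + (-1)%:P) \is @monic int.
    by rewrite monicE lead_coefDl // lead_coefXn.
  split => /=.
  - by rewrite rpredX.
  - have sQ : size ('X^2 + (2%:P * 'X + (-1)%:P) : {poly int}) = 3%N.
      by rewrite size_polyDl // size_polyXn.
    rewrite (expr2 ('X^2 + _)) [X in (_ <= X)%N]size_monicM ?monic_neq0 // sQ
      mul_polyC.
    by rewrite size_scale // size_XaddC.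
  - by rewrite -horner_coef0 !hornerE.
  - by rewrite -horner_coef0 !hornerE.
rewrite iterS; case: (iter m _ _) => C B [/= Bmon sCB C0 B0].
have sB : (0 < size B)%N by rewrite size_poly_gt0 monic_neq0.
have sXC : (size ('X * C)%R < size B)%N.
  by rewrite mulrC; apply: leq_ltn_trans (size_mul_leq _ _) _;
    rewrite (_ : size 'X = 2%N) ?size_polyX // addn2; move: sCB; rewrite addn2.
pose T := B ^+ 2 - 2%:P * 'X * C * B - 'X ^+ 2 * C ^+ 2.
(* Grouped so that everything except [B ^+ 2] visibly has lower degree. *)
have TE : T = B ^+ 2 - 'X * C * (2%:P * B + 'X * C) by rewrite /T; ring.
have sBB : size (B ^+ 2) = (size B).*2.-1.
  by rewrite size_monicM ?monic_neq0 // addnn.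
have sXCT : (size ('X * C * (2%:P * B + 'X * C))%R < size (B ^+ 2)%R)%N.
  apply: leq_ltn_trans (size_mul_leq _ _) _.
  have := size_polyD (2%:P * B) ('X * C); have := size_mul_leq (2%:P) B;
    rewrite sBB size_polyC /=.
  by move: sXC sB; clear;
    move: (size (2%:P * B)%R) (size ('X * C)%R) (size (2%:P * B + 'X * C)%R)
      (size B) => a b c d; lia.
have Tmon : T \is monic.
  by rewrite monicE TE lead_coefDl ?size_polyN // lead_coef_exp (monicP Bmon)
    expr1n.
have sT : size T = (size B).*2.-1 by rewrite TE size_polyDl ?size_polyN.
split => /=.
- by rewrite rpredX.
- rewrite -/T [X in (_ <= X)%N]size_monicM ?monic_neq0 // sT.
  have := size_mul_leq (8%:P * C * ('X * C + 2%:P * B)) (B ^+ 2).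
  have := size_mul_leq (8%:P * C) ('X * C + 2%:P * B).
  have := size_mul_leq (8%:P) C.
  have := size_polyD ('X * C) (2%:P * B); have := size_mul_leq (2%:P) B;
    rewrite sBB !size_polyC /=.
  move: sXC sB sCB; clear;
    move: (size (2%:P * B)%R) (size ('X * C)%R) (size ('X * C + 2%:P * B)%R)
      (size B) (size C) (size (8%:P * C)%R).
  move: (size (8%:P * C * ('X * C + 2%:P * B))%R)
    (size (8%:P * C * ('X * C + 2%:P * B) * B ^+ 2)%R).
  by lia.
- by rewrite -horner_coef0 !hornerE !abszM !oddM.
- rewrite -horner_coef0 !(horner_exp, hornerE) !horner_coef0.
  by rewrite !abszX !oddX B0.
Qed.

Lemma odd_horner_even (p : {poly int}) : odd `|p.[-2]| = odd `|p`_0|.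
Proof.
rewrite -horner_coef0; elim/poly_ind: p => [|p c _]; first by rewrite !horner0.
by rewrite !hornerE; lia.
Qed.

Lemma dbl_poly_eval (V : K) m :
  (forall i, (i <= m.+1)%N -> iter i dbl_map V != 0) ->
  [/\ (map_poly intr (dbl_poly m).2).[V] != 0 &
   iter m.+1 dbl_map V = V * (map_poly intr (dbl_poly m).1).[V] /
     (map_poly intr (dbl_poly m).2).[V]].
Proof.
pose ev (p : {poly int}) := (map_poly intr p).[V].
have evM p q : ev (p * q) = ev p * ev q by rewrite /ev rmorphM hornerM.
have evD p q : ev (p + q) = ev p + ev q by rewrite /ev rmorphD hornerD.
have evB p q : ev (p - q) = ev p - ev q by rewrite /ev rmorphB hornerD hornerN.
have evXn p n : ev (p ^+ n) = ev p ^+ n by rewrite /ev rmorphXn horner_exp.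
have evn n : ev (n%:R)%:P = n%:R by rewrite /ev map_polyC hornerC /= rmorph_nat.
have evX : ev 'X = V by rewrite /ev map_polyX hornerX.
have ev1 : ev 1 = 1 by rewrite /ev rmorph1 hornerC.
rewrite -!/(ev _); elim: m => [|m IH] nz; rewrite /dbl_poly.
  have := nz 1%N isT; rewrite /= /dbl_map => nz1.
  (* The inverse of 0 is 0, so a nonzero value of [dbl_map] forces a nonzero denominator. *)
  have d0 : 1 - 2 * V - V ^+ 2 != 0.
    by apply: contraNneq nz1 => ->; rewrite expr0n invr0 mulr0.
  by rewrite !(evXn, evB, evD, evM, evn, evX, ev1); rewrite expf_neq0 //;
    split=> //; field.
have [|b0 e] := IH; first by move=> i /leqW; apply: nz.
have := nz m.+2 (leqnn _); rewrite !iterS -iterS e -/(dbl_poly m); move: b0.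
case: (dbl_poly m) => C B /=; rewrite !(evXn, evB, evD, evM, evn, evX).
set b := ev B; set c := ev C => b0.
rewrite {1}/dbl_map => nz1.
have d0 : b ^+ 2 - 2 * V * c * b - V ^+ 2 * c ^+ 2 != 0.
  apply: contraNneq nz1 => z;
    have -> : 1 - 2 * (V * c / b) - (V * c / b) ^+ 2 = 0.
    by apply: (mulfI (expf_neq0 2 b0)); rewrite mulr0 -z; field.
  by rewrite expr0n invr0 mulr0.
by rewrite expf_neq0 //; split => //; rewrite /dbl_map; field;
  rewrite exprMn d0 b0.
Qed.

Lemma dbl_map0 : dbl_map 0 = 0. Proof. by rewrite /dbl_map mulr0 !mul0r. Qed.

(** If V were nonzero, it would be a root of B - C, and V + 2 a root of (B - C)(X - 2). The shift by
    2 preserves the parity of the constant term, so [odd_unit_not_twice_sqr] applies. *)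
Lemma dbl_map_periodic (V q : K) m :
  V + 2 = 2 * q ^+ 2 -> iter m.+1 dbl_map V = V -> V = 0.
Proof.
move=> Vq per; apply/eqP/negPn/negP => V0.
(* 0 is a fixed point, so a cycle through 0 contains nothing else. *)
have nz i : (i <= m.+1)%N -> iter i dbl_map V != 0.
  move=> le_im; apply: contraNneq V0 => z; rewrite -per -(subnK le_im) iterD z.
  by elim: (_ - _)%N => //= j /eqP ->; rewrite dbl_map0.
have [b0 e] := dbl_poly_eval nz.
have [Bmon sCB C0 B0] := dbl_poly_invariantP m.
move: b0 e Bmon sCB C0 B0; rewrite per;
  case: (dbl_poly m) => C B /=  b0 e Bmon sCB C0 B0.
have BCmon : B - C \is monic.
  by rewrite monicE lead_coefDl ?size_polyN ?(monicP Bmon) //; move: sCB;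
    rewrite addn2 => /ltnW.
have Rmon : (B - C) \Po ('X - 2%:P) \is monic.
  by rewrite monicE lead_coef_comp ?size_XsubC // (monicP BCmon) lead_coefXsubC
    expr1n.
have R0 : odd `|((B - C) \Po ('X - 2%:P))`_0|.
  rewrite -horner_coef0 horner_comp hornerXsubC sub0r odd_horner_even coefB.
  by move: (B`_0) (C`_0) C0 B0; clear; lia.
apply: (negP (odd_unit_not_twice_sqr q Rmon R0)).
rewrite -Vq /root map_comp_poly rmorphB /= map_polyX map_polyC horner_comp
  hornerXsubC.
rewrite /= rmorph_nat addrK rmorphB /= hornerD hornerN subr_eq0; apply/eqP.
by apply: (mulfI V0); rewrite {1}e; field.
Qed.
End OddDegree.

(** * Torsion points *)

Section Torsion.
Variable K : fieldExtType rat.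
Hypothesis odd_deg : odd (\dim {:K}).

Let not_sqr2 (z : K) : z ^+ 2 != 2. Proof. by rewrite (sqr_neq_small odd_deg).
  Qed.
Let not_sqrN2 (z : K) : z ^+ 2 != -2. Proof. by rewrite
  (sqr_neq_small odd_deg). Qed.
Let not_sqrN1 (z : K) : z ^+ 2 != -1. Proof. by rewrite
  (sqr_neq_small odd_deg). Qed.

Lemma natr_neq0 n : (n.+1%:R : K) != 0.
Proof. by rewrite -(rmorph_nat (in_alg K)) fmorph_eq0 pnatr_eq0. Qed.

Lemma two_sub_sqr_neq0 (u : K) : 2 - u ^+ 2 != 0.
Proof. by rewrite subr_eq0 eq_sym. Qed.

(** On the curve 1 + a^2 t^4 = 2 - u^2, so the [u] of the double depends on [u] alone. *)
Lemma jq_dbl_subr1 (a : K) P : on_jq a P ->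
  (jq_dbl a P).2 - 1 = dbl_map (P.2 - 1).
Proof.
case: P => t u; rewrite /on_jq /jq_dbl /dbl_map /= => h.
have e : 1 + (a * t * t) ^+ 2 = 2 - u ^+ 2 by rewrite h; ring.
have e' : 1 - 2 * (u - 1) - (u - 1) ^+ 2 = 2 - u ^+ 2 by ring.
have {}h : a ^+ 2 * t ^+ 4 = 1 - u ^+ 2 by rewrite h; ring.
by rewrite e e'; field: h; apply: two_sub_sqr_neq0.
Qed.

(** In terms of V = u - 1 the left side is V + 2, as in the hypothesis of [dbl_map_periodic]. *)
Lemma jq_dbl_addr1 (a : K) P : on_jq a P ->
  (jq_dbl a P).2 + 1 = 2 * (P.2 ^+ 2 / (2 - P.2 ^+ 2)) ^+ 2.
Proof.
case: P => t u; rewrite /on_jq /jq_dbl /= => h.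
have e : 1 + (a * t * t) ^+ 2 = 2 - u ^+ 2 by rewrite h; ring.
have {}h : a ^+ 2 * t ^+ 4 = 1 - u ^+ 2 by rewrite h; ring.
by rewrite e; field: h; apply: two_sub_sqr_neq0.
Qed.

(** Halving step by step: u = 1 comes from u = 1 or -1, u = -1 only from u = 0, and u = 0 from
    nothing because 2 is not a square. *)
Lemma jq_dbl_descent (a : K) P n : on_jq a P ->
  (iter n (jq_dbl a) P).2 = 1 -> [\/ P.2 = 1, P.2 = -1 | P.2 = 0].
Proof.
elim: n P => [|n IH] P hP; first by constructor 1.
rewrite iterSr => /(IH _ (on_jq_dbl not_sqrN1 1 hP)) {IH} [] e.
- have := jq_dbl_subr1 hP; rewrite e subrr => /esym/eqP.
  rewrite /dbl_map -mulrA !mulf_eq0 invr_eq0 expf_eq0 /= (negPf (natr_neq0 7))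
    /=.
  rewrite (_ : 1 - _ - _ = 2 - P.2 ^+ 2); last by ring.
  rewrite (negPf (two_sub_sqr_neq0 _)) orbF subr_eq0 => /orP[/eqP|/eqP] h.
    by constructor 1.
  by constructor 2; apply/eqP; rewrite -addr_eq0 -h; apply/eqP; ring.
- have := jq_dbl_addr1 hP; rewrite e addNr => /esym/eqP.
  rewrite mulf_eq0 expf_eq0 /= (negPf (natr_neq0 1)) /= mulf_eq0 invr_eq0.
  rewrite (negPf (two_sub_sqr_neq0 _)) orbF expf_eq0 => /eqP.
  by constructor 3.
- have /eqP := jq_dbl_addr1 hP; rewrite e add0r => h.
  have := not_sqr2 (2 * (P.2 ^+ 2 / (2 - P.2 ^+ 2))).
  by rewrite exprMn [2 ^+ 2]expr2 -mulrA -(eqP h) mulr1 eqxx.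
Qed.

(** Doubling eventually enters a cycle, on which u = 1 by [dbl_map_periodic]; the descent then leads
    back to P. *)
Lemma jq_torsion (a : K) P n : on_jq a P -> jq_mul a n.+1 P = (0, 1) ->
  [\/ P.2 = 1, P.2 = -1 | P.2 = 0].
Proof.
move=> hP /(jq_dbl_periodic not_sqrN1 hP)[r [m per]].
(* One doubling before re-entering the cycle: the double of [Q] is on the cycle and is visibly a
   double. *)
set Q := iter (r + m) (jq_dbl a) P.
have hQ : on_jq a Q by apply: on_jq_dbl.
have perQ : iter m.+1 (jq_dbl a) (jq_dbl a Q) = jq_dbl a Q.
  by rewrite -[jq_dbl a Q]iterS -addnS per -iterD addnC per.
apply: (@jq_dbl_descent a P (r + m.+1)) => //; rewrite addnS iterS -/Q.
apply/eqP; rewrite -subr_eq0; apply/eqP.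
apply: (@dbl_map_periodic K odd_deg _ (Q.2 ^+ 2 / (2 - Q.2 ^+ 2)) m).
  by rewrite -(jq_dbl_addr1 hQ); ring.
have E k R : on_jq a R -> iter k (@dbl_map K) (R.2 - 1) =
  (iter k (jq_dbl a) R).2 - 1.
  by move=> hR; elim: k => //= k ->; rewrite jq_dbl_subr1 //; apply: on_jq_dbl.
by rewrite E ?perQ //; apply: on_jq_add.
Qed.

(** A point of infinite order would form an independent family of size 1. *)
Lemma ec_rank0_torsion (a : K) P : ec_has_rank a 0 0 -> on_ec a 0 P ->
  exists n, iter n.+1 (ec_add a P) None = None.
Proof.
case=> _ rank0 hP; apply: contrapT => no_torsion.
suff /(rank0 1%N) : ec_independent a (fun _ : 'I_1 => P) by move/(_ (fun=> hP)).
move=> c; rewrite big_ord_recl big_ord0 => cP i; rewrite (ord1 i) {i}.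
have {}cP : ec_mulz a P (c ord0) = None.
  by move: cP => /=; case: (ec_mulz a P (c ord0)) => [[? ?]|].
case: (c ord0) cP => [[|n]|n] // h; case: no_torsion; exists n => //.
by move: h; rewrite /ec_mulz; case: (iter _ _ _) => [[? ?]|].
Qed.

Lemma jq_mul_morph (a b : K) (phi : ec_point K -> K * K) : phi None = (0, 1) ->
  (forall P Q, on_ec a 0 P -> on_ec a 0 Q ->
     phi (ec_add a P Q) = jq_add b (phi P) (phi Q)) ->
  forall P n, on_ec a 0 P ->
    phi (iter n (ec_add a P) None) = jq_mul b n (phi P).
Proof.
move=> phi0 phiD P n hP.
suff [] : on_ec a 0 (iter n (ec_add a P) None) /\
    phi (iter n (ec_add a P) None) = jq_mul b n (phi P) by [].
elim: n => [|n [h IH]] //; split; first by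
  apply: on_ec_add => //; apply: natr_neq0.
by rewrite /jq_mul !iterS phiD // IH.
Qed.

(** The image on the quartic has u = (x^2-4)/(x^2+4) in {1, -1, 0}: u = 1 is impossible, u = -1
    gives x = 0, u = 0 gives x = 2 or -2, and x = -2 would make y^2 = -16. *)
Lemma E1_points (x y : K) : ec_has_rank (4 : K) 0 0 ->
  y ^+ 2 = x ^+ 3 + 4 * x -> x = 0 \/ x = 2.
Proof.
move=> rank0 h; have two0 := natr_neq0 1.
have hP : on_ec 4 0 (Some (x, y)) by rewrite /= addr0 h.
have [n nP] := ec_rank0_torsion rank0 hP.
have := jq_mul_morph (erefl : jq_of_E1 None = (0, 1))
  (jq_of_E1_add not_sqrN1 two0) n.+1 hP.
rewrite nP /= => /esym /(jq_torsion (on_jq_of_E1 not_sqrN1 two0 hP)).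
have d0 := sqr_add4_neq0 not_sqrN1 two0 x.
case=> /= /(canRL (mulfVK d0)) /eqP.
- rewrite mul1r -subr_eq0 (_ : _ - _ = - (8 : K)); last by ring.
  by rewrite oppr_eq0 (negPf (natr_neq0 7)).
- rewrite mulN1r -subr_eq0 (_ : _ - _ = 2 * x ^+ 2); last by ring.
  by rewrite mulf_eq0 (negPf two0) expf_eq0 => /eqP; left.
- rewrite mul0r (_ : _ - _ = (x - 2) * (x + 2)); last by ring.
  rewrite mulf_eq0 subr_eq0 addr_eq0 => /orP[/eqP|/eqP xN2]; first by right.
  have := not_sqrN1 (y / 4); rewrite expr_div_n h xN2.
  rewrite (_ : _ / _ = -1) ?eqxx //; field; exact: natr_neq0.
Qed.

(** Here u = 1 gives x = 0 and u = -1 gives x^2 = 4, while u = 0 means 4 t^4 = 1, so that (2t)^2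
    would be 2 or -2. *)
Lemma E2_points (x y : K) : ec_has_rank (- 4 : K) 0 0 ->
  y ^+ 2 = x ^+ 3 - 4 * x -> [\/ x = 0, x = 2 | x = -2].
Proof.
move=> rank0 h; have two0 := natr_neq0 1.
have hP : on_ec (-4) 0 (Some (x, y)) by rewrite /= addr0 h mulNr.
have [n nP] := ec_rank0_torsion rank0 hP.
have := jq_mul_morph (erefl : jq_of_E2 None = (0, 1))
  (jq_of_E2_add not_sqrN1 two0) n.+1 hP.
rewrite nP /= => /esym /(jq_torsion (on_jq_of_E2 not_sqrN1 two0 hP)).
have d0 := sqr_add4_neq0 not_sqrN1 two0 x; have d02 := expf_neq0 2 d0.
case=> /= u_eq; move: (u_eq) => /(canRL (mulfVK d02)) /eqP.
- rewrite mul1r -subr_eq0 (_ : _ - _ = - (32 * x ^+ 2)); last by ring.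
  by rewrite oppr_eq0 mulf_eq0 (negPf (natr_neq0 31)) expf_eq0 => /eqP;
    constructor 1.
- rewrite mulN1r -subr_eq0 (_ : _ - _ = 2 * ((x - 2) * (x + 2)) ^+ 2);
  last by ring.
  rewrite mulf_eq0 (negPf two0) expf_eq0 /= mulf_eq0 subr_eq0 addr_eq0.
  by case/orP => /eqP; [constructor 2 | constructor 3].
- move=> _; have := on_jq_of_E2 not_sqrN1 two0 hP; rewrite /on_jq /= u_eq.
  set t := 2 * y / _ => /eqP;
    rewrite expr0n /= (_ : 1 - _ = (1 - 2 * t ^+ 2) * (1 + 2 * t ^+ 2));
      last by ring.
  rewrite eq_sym mulf_eq0 => /orP[]/eqP e.
    have := not_sqr2 (2 * t); rewrite (_ : _ ^+ 2 = 2 - 2 * (1 - 2 * t ^+ 2));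
      last by ring.
    by rewrite e mulr0 subr0 eqxx.
  have := not_sqrN2 (2 * t); rewrite (_ : _ ^+ 2 = -2 + 2 * (1 + 2 * t ^+ 2));
    last by ring.
  by rewrite e mulr0 addr0 eqxx.
Qed.
End Torsion.

(** * Quadratic points on the Fermat quartic *)

Section QuadraticElements.
Variables (K M : fieldType) (f : {rmorphism K -> M}) (D : K) (d : M).
Hypothesis d_sqr : d ^+ 2 = f D.
Hypothesis D_nonsqr : forall c : K, c ^+ 2 != D.

Definition quadratic (z : M) := exists a b : K, z = f a + f b * d.

(** If b and b' differed, d would be the image of (a - a')/(b' - b), a square root of D in K. *)
Lemma quad_coord_inj a b a' b' :
  f a + f b * d = f a' + f b' * d -> a = a' /\ b = b'.
Proof.
move=> e; have {}e : f (a - a') = f (b' - b) * d.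
  by rewrite !rmorphB mulrBl -[f a](addrK (f b * d)) e; ring.
have [bb|bb] := eqVneq b' b.
  move/eqP: e; rewrite bb subrr rmorph0 mul0r fmorph_eq0 subr_eq0.
  by move/eqP.
have b0 : b' - b != 0 by rewrite subr_eq0.
case/eqP: (D_nonsqr ((a - a') / (b' - b))).
apply: (fmorph_inj f);
  rewrite rmorphXn fmorph_div e -d_sqr mulrAC mulfV ?mul1r //.
by rewrite fmorph_eq0.
Qed.

Lemma quad_norm_neq0 a b : f a + f b * d != 0 -> a ^+ 2 - D * b ^+ 2 != 0.
Proof.
have [-> |b0 _] := eqVneq b 0.
  by rewrite rmorph0 mul0r addr0 fmorph_eq0 expr0n mulr0 subr0 expf_eq0.
rewrite subr_eq0; apply: contra (D_nonsqr (a / b)) => /eqP e.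
by rewrite expr_div_n e mulfK ?expf_neq0.
Qed.

Lemma quadM z w : quadratic z -> quadratic w -> quadratic (z * w).
Proof.
case=> [a [b ->]] [a' [b' ->]]; exists (a * a' + D * b * b'), (a * b' + b * a').
by rewrite !(rmorphD, rmorphM) /= -d_sqr; ring.
Qed.

Lemma quadV z : quadratic z -> quadratic z^-1.
Proof.
case=> [a [b ->]]; have [->|z0] := eqVneq (f a + f b * d) 0.
  by exists 0, 0; rewrite invr0 rmorph0 mul0r addr0.
have N0 := quad_norm_neq0 z0; set N := _ - _ in N0.
have fN : (f a + f b * d) * (f a - f b * d) = f N.
  by rewrite /N rmorphB !(rmorphXn, rmorphM) /= -d_sqr; ring.
have fN0 : f N != 0 by rewrite fmorph_eq0.
exists (a / N), (- b / N); apply: (mulfI z0); rewrite mulfV //.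
rewrite -(mulfV fN0) -{1}fN !fmorph_div rmorphN /=.
by field.
Qed.

Lemma quad_K a : quadratic (f a).
Proof. by exists a, 0; rewrite rmorph0 mul0r addr0. Qed.

Lemma quad_eqK a b c : f a + f b * d = f c -> a = c /\ b = 0.
Proof.
by move=> e; apply: quad_coord_inj; rewrite e rmorph0 mul0r addr0.
Qed.

Lemma quad_sqr a b :
  (f a + f b * d) ^+ 2 = f (a ^+ 2 + D * b ^+ 2) + f (2 * a * b) * d.
Proof. by ring: d_sqr. Qed.

End QuadraticElements.

(** * K-points of the auxiliary genus 1 quartics *)

Section Curves.
Variable K : fieldExtType rat.
Hypothesis odd_deg : odd (\dim {:K}).
Hypothesis rank_E1 : ec_has_rank (4 : K) 0 0.
Hypothesis rank_E2 : ec_has_rank (- 4 : K) 0 0.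

Let not_sqr2 (z : K) : z ^+ 2 != 2. Proof. by rewrite (sqr_neq_small odd_deg).
  Qed.
Let not_sqrN2 (z : K) : z ^+ 2 != -2. Proof. by rewrite
  (sqr_neq_small odd_deg). Qed.
Let not_sqrN1 (z : K) : z ^+ 2 != -1. Proof. by rewrite
  (sqr_neq_small odd_deg). Qed.
Let two0 : (2 : K) != 0. Proof. exact: natr_neq0. Qed.

(** For y nonzero, 2(1+u)/y^2 is the x-coordinate of a point of E1, hence 0 or 2. *)
Lemma quartic_sub_points (u y : K) : u ^+ 2 = 1 - y ^+ 4 -> y = 0 \/ u = 0.
Proof.
move=> h; have [->|y0] := eqVneq y 0; [by left|right].
have hE : (4 * (1 + u) / y ^+ 3) ^+ 2
    = (2 * (1 + u) / y ^+ 2) ^+ 3 + 4 * (2 * (1 + u) / y ^+ 2) by field: h.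
have y20 := expf_neq0 2 y0.
case: (E1_points odd_deg rank_E1 hE) => /(canRL (mulfVK y20)) e.
  move/eqP: e; rewrite mul0r mulf_eq0 (negPf two0) /= addrC addr_eq0 => /eqP u1.
  have /eqP : y ^+ 4 = 0 by rewrite -[LHS](subKr 1) -h u1; ring.
  by rewrite expf_eq0 (negPf y0).
have {}e : u = y ^+ 2 - 1 by rewrite -(mulfI two0 e); ring.
have /eqP : 2 * y ^+ 2 * u = 0.
  by rewrite [in LHS]e; have := h; rewrite e => h';
    apply: etrans (_ : _ = (y ^+ 2 - 1) ^+ 2 - (1 - y ^+ 4)) _;
      [ring|rewrite h' subrr].
by rewrite !mulf_eq0 (negPf two0) (negPf y0) => /eqP.
Qed.

(** For y nonzero, 2(1+w)/y^2 is the x-coordinate of a point of E2; each of 0, 2, -2 forces y =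
    0. *)
Lemma quartic_add_points (w y : K) : w ^+ 2 = 1 + y ^+ 4 -> y = 0.
Proof.
move=> h; apply/eqP; apply/negPn/negP => y0.
have hE : (4 * (1 + w) / y ^+ 3) ^+ 2
    = (2 * (1 + w) / y ^+ 2) ^+ 3 - 4 * (2 * (1 + w) / y ^+ 2) by field: h.
have y20 := expf_neq0 2 y0.
have y40 : 2 * y ^+ 2 != 0 by rewrite mulf_neq0.
case: (E2_points odd_deg rank_E2 hE) => /(canRL (mulfVK y20)) e.
- move/eqP: e; rewrite mul0r mulf_eq0 (negPf two0) /= addrC addr_eq0 => /eqP w1.
  have /eqP : y ^+ 4 = 0 by rewrite -[LHS](addKr 1) -h w1; ring.
  by rewrite expf_eq0 (negPf y0).
- have {}e : w = y ^+ 2 - 1 by rewrite -(mulfI two0 e); ring.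
  case/eqP: y40; apply: (@subrI _ 0); rewrite subr0 sub0r.
  have -> : - (2 * y ^+ 2) = w ^+ 2 - (1 + y ^+ 4) by rewrite e; ring.
  by rewrite h subrr.
- have {}e : w = - y ^+ 2 - 1 by rewrite mulNr -mulrN in e;
  rewrite -(mulfI two0 e); ring.
  case/eqP: y40; have -> : 2 * y ^+ 2 = w ^+ 2 - (1 + y ^+ 4) by rewrite e;
    ring.
  by rewrite h subrr.
Qed.

(** The curve maps to E1 by x = 2 s^2. *)
Lemma quartic_twist_points (r s : K) : r ^+ 2 = 2 * s ^+ 4 + 2 ->
  s = 0 \/ s ^+ 2 = 1.
Proof.
move=> h.
have hE : (2 * r * s) ^+ 2 = (2 * s ^+ 2) ^+ 3 + 4 * (2 * s ^+ 2) by ring: h.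
case: (E1_points odd_deg rank_E1 hE) => /eqP.
  by rewrite mulf_eq0 (negPf two0) expf_eq0 => /eqP; left.
by rewrite -[X in _ == X]mulr1 => /eqP/(mulfI two0); right.
Qed.

(** The curve maps to E2 by x = (s/t)^2, a square, so x is neither 2 nor -2; x = 0 would give
    (t^2)^2 = -1. *)
Lemma quartic_neg_no_points (s t : K) : s ^+ 2 != - 1 - t ^+ 4.
Proof.
apply/eqP => h; have t0 : t != 0.
  by apply: contra_eq_neq h => ->; rewrite expr0n subr0.
have hE : (s * (1 - t ^+ 4) / t ^+ 3) ^+ 2
    = ((s / t) ^+ 2) ^+ 3 - 4 * (s / t) ^+ 2 by field: h.
case: (E2_points odd_deg rank_E2 hE) => /eqP; last 2 first.
- by rewrite (negPf (not_sqr2 _)).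
- by rewrite (negPf (not_sqrN2 _)).
rewrite expf_eq0 mulf_eq0 invr_eq0 (negPf t0) orbF /= => /eqP s0.
have := not_sqrN1 (t ^+ 2); rewrite -exprM -[_ ^+ _](subKr (-1)) -h s0.
by rewrite expr0n subr0 eqxx.
Qed.

(** * Points of the Fermat quartic over K(d) *)

Section QuadraticPoints.
Variables (M : fieldType) (f : {rmorphism K -> M}) (D : K) (d : M).
Hypothesis d_sqr : d ^+ 2 = f D.
Hypothesis D_nonsqr : forall c : K, c ^+ 2 != D.
Local Notation quad := (quadratic f d).

Lemma quad_sqr_K a b c : (f a + f b * d) ^+ 2 = f c -> a = 0 \/ b = 0.
Proof.
rewrite (quad_sqr d_sqr) => /(quad_eqK d_sqr D_nonsqr)[_ /eqP];
  rewrite !mulf_eq0 (negPf two0) /=.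
by case/orP => /eqP; [left | right].
Qed.

(** A coordinate whose square is in K is in K or in K d. If one is in K, the point gives a K-point
    of u^2 = 1 - y^4. If both are in K d, then 1/a^2 = 1 + (y1/x1)^4. *)
Lemma fermat_sqr_K x y (a b : K) : quad x -> quad y ->
  x ^+ 4 + y ^+ 4 = 1 -> x ^+ 2 = f a -> y ^+ 2 = f b -> x = 0 \/ y = 0.
Proof.
move=> [x0 [x1 xE]] [y0 [y1 yE]] xy xa yb.
have ab : a ^+ 2 + b ^+ 2 = 1.
  apply: (fmorph_inj f); rewrite rmorphD !rmorphXn /= -xa -yb -!exprM xy.
  by rewrite rmorph1.
have [b1|b1] := eqVneq x1 0.
  have xK : x = f x0 by rewrite xE b1 rmorph0 mul0r addr0.
  have ax : a = x0 ^+ 2 by apply: (fmorph_inj f); rewrite -xa xK rmorphXn.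
  have : b ^+ 2 = 1 - x0 ^+ 4 by rewrite -ab ax; ring.
  case/quartic_sub_points => e; [left|right]; first by rewrite xK e rmorph0.
  by apply/eqP; rewrite -sqrf_eq0 yb e rmorph0.
have [c1|c1] := eqVneq y1 0.
  have yK : y = f y0 by rewrite yE c1 rmorph0 mul0r addr0.
  have bY : b = y0 ^+ 2 by apply: (fmorph_inj f); rewrite -yb yK rmorphXn.
  have : a ^+ 2 = 1 - y0 ^+ 4 by rewrite -ab bY; ring.
  case/quartic_sub_points => e; [right|left]; first by rewrite yK e rmorph0.
  by apply/eqP; rewrite -sqrf_eq0 xa e rmorph0.
have x00 : x0 = 0.
  by case: (@quad_sqr_K x0 x1 a _) => //; [rewrite -xE|move/eqP: b1].
have y00 : y0 = 0.
  by case: (@quad_sqr_K y0 y1 b _) => //; [rewrite -yE|move/eqP: c1].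
have aE : a = D * x1 ^+ 2.
  apply: (fmorph_inj f); rewrite -xa xE x00; ring: d_sqr.
have bE : b = D * y1 ^+ 2.
  apply: (fmorph_inj f); rewrite -yb yE y00; ring: d_sqr.
have D0 : D != 0 by have := D_nonsqr 0; rewrite expr0n eq_sym.
have e : D ^+ 2 * (x1 ^+ 4 + y1 ^+ 4) = 1 by rewrite -ab aE bE; ring.
case/eqP: c1; apply/eqP.
have : (a^-1) ^+ 2 = 1 + (y1 / x1) ^+ 4.
  by rewrite -[LHS]mul1r -[in LHS]e aE; field; rewrite b1 D0.
by move/quartic_add_points/eqP; rewrite mulf_eq0 invr_eq0 (negPf b1) orbF.
Qed.

(** Writing x^2 = A + B d, the element x^4 = 1/(1+t^4) of K forces A B = 0. If B = 0, then x^2 and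
    y^2 are in K; if A = 0, then x^4 = -4 x0^4 and 1/(2 x0^2) is a square root of -1 - t^4. *)
Lemma fermat_slope_K x y t : quad x -> x ^+ 4 + y ^+ 4 = 1 -> y = f t * x ->
  x = 0 \/ y = 0.
Proof.
move=> qx xy yE; have [x0 [x1 xE]] := qx.
have qy : quad y by rewrite yE; apply: (quadM d_sqr) => //; apply: quad_K.
pose A := x0 ^+ 2 + D * x1 ^+ 2; pose B := 2 * x0 * x1.
have [e1 e2] : (A ^+ 2 + D * B ^+ 2) * (1 + t ^+ 4) = 1 /\ 2 * A * B *
  (1 + t ^+ 4) = 0.
  apply: (quad_eqK d_sqr D_nonsqr); rewrite rmorph1 -xy yE xE /A /B;
    ring: d_sqr.
have t1 : 1 + t ^+ 4 != 0 by apply: contra_eq_neq e1 => ->;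
  rewrite mulr0 eq_sym oner_neq0.
move/eqP: e2; rewrite mulf_eq0 (negPf t1) orbF mulf_eq0 mulf_eq0 (negPf two0)
  /=.
case/orP => /eqP z; last first.
  apply: (@fermat_sqr_K x y A (t ^+ 2 * A)) => //;
    first by rewrite xE (quad_sqr d_sqr) -/A -/B z rmorph0 mul0r addr0.
  by rewrite yE xE exprMn (quad_sqr d_sqr) -/A -/B z; ring.
have x0A : x0 ^+ 2 = - (D * x1 ^+ 2) by apply/eqP; rewrite -addr_eq0; apply/eqP.
have e3 : - 4 * x0 ^+ 4 * (1 + t ^+ 4) = 1.
  by rewrite -[RHS]e1 z /B; ring: x0A.
have x00 : x0 != 0 by apply: contra_eq_neq e3 => ->;
  rewrite expr0n mulr0 mul0r eq_sym oner_neq0.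
have := quartic_neg_no_points (1 / (2 * x0 ^+ 2)) t; case/eqP.
have e4 : 1 + t ^+ 4 = - 1 / (4 * x0 ^+ 4).
  by rewrite -[RHS]mulr1 -[X in _ = _ * X]e3; field; rewrite x00 natr_neq0.
by rewrite -opprD e4; field; rewrite x00 !natr_neq0.
Qed.

(** Unless x^2 and y^2 are in K, y is the conjugate of x up to sign, and the quartic becomes an
    equation between the trace and the norm of x. *)
Lemma fermat_mul_add_K x y p S : quad x -> quad y -> x ^+ 4 + y ^+ 4 = 1 ->
    x * y = f p -> x ^+ 2 + y ^+ 2 = f S ->
  [\/ x = 0, y = 0 | exists (th s e : M),
     [/\ th ^+ 2 = -7, s ^+ 2 = 1, e ^+ 2 = 1,
       2 * x = s + th & 2 * y = e * (s - th)]].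
Proof.
move=> qx qy xy xyp xyS; have [[x0 [x1 xE]] [y0 [y1 yE]]] := (qx, qy).
have [_ e1] : x0 * y0 + D * x1 * y1 = p /\ x0 * y1 + x1 * y0 = 0.
  by apply: (quad_eqK d_sqr D_nonsqr); rewrite -xyp xE yE; ring: d_sqr.
have [e2 e3] : x0 ^+ 2 + D * x1 ^+ 2 + y0 ^+ 2 + D * y1 ^+ 2 = S
    /\ 2 * (x0 * x1 + y0 * y1) = 0.
  by apply: (quad_eqK d_sqr D_nonsqr); rewrite -xyS xE yE; ring: d_sqr.
have {}e3 : x0 * x1 + y0 * y1 = 0.
  by move/eqP: e3; rewrite mulf_eq0 (negPf two0) => /eqP.
have [z|nz] := eqVneq (x0 * x1) 0.
  pose A := x0 ^+ 2 + D * x1 ^+ 2.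
  have xA : x ^+ 2 = f A by rewrite xE (quad_sqr d_sqr) -mulrA z mulr0 rmorph0
    mul0r addr0.
  have [] := @fermat_sqr_K x y A (S - A) qx qy xy xA.
  - by rewrite rmorphB /= -xyS -xA addrAC subrr add0r.
  - by constructor 1.
  - by constructor 2.
have [x00 x10] : x0 != 0 /\ x1 != 0 by apply/andP; rewrite -negb_or -mulf_eq0.
have y1E : y1 = - (x1 * y0) / x0.
  by apply: (mulfI x00); rewrite mulrCA mulfV // mulr1; apply/eqP;
    rewrite -addr_eq0 e1.
have [e eE ee] : exists2 e : K, y0 = e * x0 & e ^+ 2 = 1.
  exists (y0 / x0); first by rewrite mulfVK.
  have : x1 / x0 * (x0 ^+ 2 - y0 ^+ 2) = 0 by rewrite -e3 y1E; field.
  move/eqP; rewrite !mulf_eq0 invr_eq0 (negPf x10) (negPf x00) /= subr_eq0 =>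
    /eqP h.
  by rewrite expr_div_n -h mulfV // expf_neq0.
have {}y1E : y1 = - e * x1 by rewrite y1E eE; field.
(* Trace and norm of x. *)
pose s := 2 * x0; pose p' := x0 ^+ 2 - D * x1 ^+ 2.
have pe : p = e * p'.
  by apply: (fmorph_inj f); rewrite -xyp xE yE eE y1E /p'; ring: d_sqr.
have SE : S = s ^+ 2 - 2 * p' by rewrite -e2 eE y1E /s /p'; ring: ee.
have sp : (s ^+ 2 - 2 * p') ^+ 2 - 2 * p' ^+ 2 = 1.
  have -> : p' ^+ 2 = p ^+ 2 by rewrite pe exprMn ee mul1r.
  apply: (fmorph_inj f); rewrite rmorph1 -SE -xy.
  by rewrite rmorphB !(rmorphXn, rmorphM) rmorph_nat /= -xyS -xyp; ring.
(* Completing the square in [sp], read as a quadratic equation for [p']. *)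
have : (2 * p' - 2 * s ^+ 2) ^+ 2 = 2 * s ^+ 4 + 2.
  rewrite (_ : 2 * s ^+ 4 + 2 = 2 * s ^+ 4 + 2 * 1); last by rewrite mulr1.
  by rewrite -[X in _ = _ + _ * X]sp; ring.
case/quartic_twist_points => sE.
  by case/eqP: x00; move/eqP: sE; rewrite mulf_eq0 (negPf two0) => /eqP.
have /eqP : 2 * p' * (p' - 2) = 0.
  have -> : 2 * p' * (p' - 2) = (s ^+ 2 - 2 * p') ^+ 2 - 2 * p' ^+ 2 - 1 by
    ring: sE.
  by rewrite sp subrr.
rewrite !mulf_eq0 (negPf two0) /= => /orP[/eqP z | ].
  case/eqP: (D_nonsqr (x0 / x1)); rewrite expr_div_n.
  have -> : x0 ^+ 2 = D * x1 ^+ 2 by apply/eqP; rewrite -subr_eq0 -/p' z.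
  by rewrite mulfK // expf_neq0.
rewrite subr_eq0 => /eqP p2; constructor 3.
(* [th] is x minus its conjugate, so its square is the discriminant s^2 - 4 p' = 1 - 8. *)
exists (2 * f x1 * d), (f s), (f e); split.
- have e4 : 4 * (D * x1 ^+ 2) = s ^+ 2 - 4 * p' by rewrite /s /p'; ring.
  rewrite (_ : _ ^+ 2 = f (4 * (D * x1 ^+ 2))); last by ring: d_sqr.
  by rewrite e4 sE p2; ring.
- by rewrite -rmorphXn sE rmorph1.
- by rewrite -rmorphXn ee rmorph1.
- by rewrite xE /s; ring.
- by rewrite yE eE y1E /s; ring.
Qed.

(** With the minus sign the exceptional case would give x0^2 + y0^2 = 0, making -1 a square. *)
Lemma fermat_mul_sub_K x y p S : quad x -> quad y -> x ^+ 4 + y ^+ 4 = 1 ->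
  x * y = f p -> x ^+ 2 - y ^+ 2 = f S -> x = 0 \/ y = 0.
Proof.
move=> qx qy xy xyp xyS; have [[x0 [x1 xE]] [y0 [y1 yE]]] := (qx, qy).
have [_ e1] : x0 * y0 + D * x1 * y1 = p /\ x0 * y1 + x1 * y0 = 0.
  by apply: (quad_eqK d_sqr D_nonsqr); rewrite -xyp xE yE; ring: d_sqr.
have [_ e3] : x0 ^+ 2 + D * x1 ^+ 2 - y0 ^+ 2 - D * y1 ^+ 2 = S
    /\ 2 * (x0 * x1 - y0 * y1) = 0.
  by apply: (quad_eqK d_sqr D_nonsqr); rewrite -xyS xE yE; ring: d_sqr.
have {}e3 : x0 * x1 - y0 * y1 = 0.
  by move/eqP: e3; rewrite mulf_eq0 (negPf two0) => /eqP.
have [z|nz] := eqVneq (x0 * x1) 0.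
  pose A := x0 ^+ 2 + D * x1 ^+ 2.
  have xA : x ^+ 2 = f A by rewrite xE (quad_sqr d_sqr) -mulrA z mulr0 rmorph0
    mul0r addr0.
  apply: (@fermat_sqr_K x y A (A - S) qx qy xy xA).
  by rewrite rmorphB /= -xyS -xA opprB addrC subrK.
have [x00 x10] : x0 != 0 /\ x1 != 0 by apply/andP; rewrite -negb_or -mulf_eq0.
have y1E : y1 = - (x1 * y0) / x0.
  by apply: (mulfI x00); rewrite mulrCA mulfV // mulr1; apply/eqP;
    rewrite -addr_eq0 e1.
case/eqP: (not_sqrN1 (y0 / x0)).
have : x1 / x0 * (x0 ^+ 2 + y0 ^+ 2) = 0 by rewrite -e3 y1E; field.
move/eqP; rewrite !mulf_eq0 invr_eq0 (negPf x10) (negPf x00) /= addrC addr_eq0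
  => /eqP h.
by rewrite expr_div_n h mulNr mulfV // expf_neq0.
Qed.

(** Otherwise z = x/y satisfies z^4 = -1. Writing z^2 = A + B d, either B = 0 and A^2 = -1, or A = 0
    and 4 x0^4 = 1, so that (2 x0)^2 is 2 or -2. *)
Lemma fermat_infinity x y : quad x -> quad y -> x ^+ 4 + y ^+ 4 = 0 -> y = 0.
Proof.
move=> qx qy xy; apply/eqP/negPn/negP => y0.
have [x0 [x1 zE]] : quad (x / y) by apply: (quadM d_sqr) => //;
  apply: (quadV d_sqr D_nonsqr).
have z4 : (x / y) ^+ 4 = -1.
  by rewrite expr_div_n (canRL (addrK _) xy) add0r mulNr mulfV ?expf_neq0.
pose A := x0 ^+ 2 + D * x1 ^+ 2; pose B := 2 * x0 * x1.
have [e1 e2] : A ^+ 2 + D * B ^+ 2 = -1 /\ 2 * A * B = 0.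
  by apply: (quad_eqK d_sqr D_nonsqr); rewrite rmorphN1 -z4 zE /A /B;
    ring: d_sqr.
move/eqP: e2; rewrite mulf_eq0 mulf_eq0 (negPf two0) /= => /orP[]/eqP z;
  last first.
  by case/eqP: (not_sqrN1 A); rewrite -e1 z expr0n mulr0 addr0.
have x0A : x0 ^+ 2 = - (D * x1 ^+ 2) by apply/eqP; rewrite -addr_eq0; apply/eqP.
have : (2 * x0 ^+ 2 - 1) * (2 * x0 ^+ 2 + 1) = 0.
  have -> : (2 * x0 ^+ 2 - 1) * (2 * x0 ^+ 2 + 1) = 4 * x0 ^+ 4 + (-1) by ring.
  rewrite -[X in _ + X]e1 z /B; apply/eqP; rewrite addr_eq0; apply/eqP;
    ring: x0A.
move/eqP; rewrite mulf_eq0 => /orP[]/eqP h.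
  case/eqP: (not_sqr2 (2 * x0)).
  by rewrite (_ : _ ^+ 2 = 2 * (2 * x0 ^+ 2 - 1) + 2);
    [rewrite h mulr0 add0r | ring].
case/eqP: (not_sqrN2 (2 * x0)).
by rewrite (_ : _ ^+ 2 = 2 * (2 * x0 ^+ 2 + 1) - 2);
  [rewrite h mulr0 add0r | ring].
Qed.

(* The parabola w = 1 + b t + c t^2 through the two conjugate points of
   w^2 = 1 + t^4 and (0, 1) meets the curve in one more point, which is defined
   over K unless c^2 = 1. *)
Lemma fermat_quad_points x y : quad x -> quad y -> x ^+ 4 + y ^+ 4 = 1 ->
  [\/ x = 0, y = 0 | exists (th s e : M),
     [/\ th ^+ 2 = -7, s ^+ 2 = 1, e ^+ 2 = 1,
       2 * x = s + th & 2 * y = e * (s - th)]].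
Proof.
move=> qx qy xy; have [->|x0] := eqVneq x 0; first by constructor 1.
have [->|y0] := eqVneq y 0; first by constructor 2.
have [t0 [t1 tE]] : quad (y / x) by apply: (quadM d_sqr) => //;
  apply: (quadV d_sqr D_nonsqr).
set t := y / x in tE.
have yE : y = t * x by rewrite mulfVK.
have t_neq0 : t != 0 by rewrite mulf_neq0 ?invr_eq0.
have [t10|t10] := eqVneq t1 0.
  have [] := @fermat_slope_K x y t0 qx xy.
  - by rewrite yE tE t10 rmorph0 mul0r addr0.
  - by constructor 1.
  - by constructor 2.
pose W := 1 / x ^+ 2.
(* As t is outside K, 1 and t form a basis of K(d); [b] and [c] are the coordinates of (W - 1)/t. *)
have [b [c WE]] : exists b c, W = 1 + f b * t + f c * t ^+ 2.
  have [w0 [w1 wE]] : quad ((W - 1) / t).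
    apply: (quadM d_sqr); last by apply: (quadV d_sqr D_nonsqr); exists t0, t1.
    have [w0 [w1 wE]] : quad W by rewrite /W div1r expr2;
      apply: (quadV d_sqr D_nonsqr); apply: (quadM d_sqr).
    by exists (w0 - 1), w1; rewrite wE rmorphB rmorph1 addrAC.
  exists (w0 - w1 / t1 * t0), (w1 / t1).
  have ft1 : f t1 != 0 by rewrite fmorph_eq0.
  rewrite -[LHS](subrK 1) -[W - 1](mulfVK t_neq0) wE tE
    !(rmorphB, rmorphM, fmorphV) /=.
  by field.
have W2 : W ^+ 2 = 1 + t ^+ 4.
  have -> : 1 + t ^+ 4 = (x ^+ 4 + y ^+ 4) / x ^+ 4 by rewrite /t; field.
  by rewrite xy /W; field.
pose s := 2 * t0; pose n := t0 ^+ 2 - D * t1 ^+ 2.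
have t2 : t ^+ 2 = f s * t - f n by rewrite tE /s /n; ring: d_sqr.
have tK p q : f p + f q * t = 0 -> p = 0 /\ q = 0.
  rewrite tE => h; have [] : p + q * t0 = 0 /\ q * t1 = 0.
    by apply: (quad_eqK d_sqr D_nonsqr); rewrite rmorph0 -h; ring.
  move=> h1 /eqP; rewrite mulf_eq0 (negPf t10) orbF => /eqP q0.
  by rewrite q0 mul0r addr0 in h1.
pose e := 1 - c ^+ 2.
(* Divided by t, the intersection equation is the cubic e t^3 - 2bc t^2 - (b^2+2c) t - 2b = 0; these
   are the coefficients of its remainder modulo t^2 - s t + n. *)
have [eP eQ] : - (e * s * n) + 2 * b * c * n - 2 * b = 0 /\
    e * (s ^+ 2 - n) - 2 * b * c * s - (b ^+ 2 + 2 * c) = 0.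
  apply: tK; apply: (mulfI t_neq0); rewrite mulr0.
  have : 1 + t ^+ 4 - (1 + f b * t + f c * t ^+ 2) ^+ 2 = 0.
    by rewrite -WE W2 subrr.
  move=> <-; rewrite /e; ring: t2.
have qW : x ^+ 2 * (1 + f b * t + f c * t ^+ 2) = 1.
  by rewrite -WE /W; field.
(* If c^2 = 1, the cubic drops in degree, which forces n = c. Then x y = 1/(b + c s) and y^2 + n x^2
   = s x y are both in K. *)
have [ce|e0] := eqVneq e 0.
  have c1 : c = 1 \/ c = -1.
    have : (c - 1) * (c + 1) = - e by rewrite /e; ring.
    rewrite ce oppr0 => /eqP; rewrite mulf_eq0 subr_eq0 addr_eq0.
    by case/orP=> /eqP; [left|right].
  have bn : b * (c * n - 1) = 0.
    apply: (mulfI two0); rewrite mulr0 -eP ce; ring.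
  have b0 : b != 0.
    move/eqP: eQ; rewrite ce mul0r sub0r; apply: contraTneq => ->.
    by case: c1 => ->; rewrite mulr0 !mul0r expr0n oppr0 !add0r oppr_eq0
      mulf_neq0 ?oppr_eq0 ?oner_neq0.
  have {}bn : c * n = 1.
    by move/eqP: bn; rewrite mulf_eq0 (negPf b0) subr_eq0 => /eqP.
  have y2 : y ^+ 2 = f s * (x * y) - f n * x ^+ 2.
    by rewrite yE exprMn t2; ring.
  case: c1 => cE; rewrite cE in bn qW.
    have n1 : n = 1 by rewrite -bn mul1r.
    have xyp : f (s + b) * (x * y) = 1.
      by rewrite -[RHS]qW rmorph1 mul1r t2 yE n1; ring.
    have sb0 : f (s + b) != 0.
      by apply: contra_eq_neq xyp => ->; rewrite mul0r eq_sym oner_neq0.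
    have {}xyp : x * y = f (s + b)^-1 by rewrite fmorphV -[RHS]mulr1 -xyp mulKf.
    apply: (@fermat_mul_add_K x y _ (s / (s + b)) qx qy xy xyp).
    by rewrite y2 n1 rmorph1 mul1r addrC subrK xyp -rmorphM.
  have n1 : n = -1 by rewrite -bn mulN1r opprK.
  have xyp : f (b - s) * (x * y) = 1.
    by rewrite -[RHS]qW rmorphN1 mulN1r t2 yE n1; ring.
  have bs0 : f (b - s) != 0.
    by apply: contra_eq_neq xyp => ->; rewrite mul0r eq_sym oner_neq0.
  have {}xyp : x * y = f (b - s)^-1 by rewrite fmorphV -[RHS]mulr1 -xyp mulKf.
  have [] := @fermat_mul_sub_K x y _ (- s / (b - s)) qx qy xy xyp.
  - by rewrite y2 n1 rmorphN1 mulN1r opprK xyp !(rmorphN, rmorphM) /=; ring.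
  - by constructor 1.
  - by constructor 2.
(* The third root of the cubic: the roots sum to 2bc/e, and t and its conjugate to s. *)
pose T := (2 * b * c - e * s) / e.
have eT : e * T = 2 * b * c - e * s by rewrite mulrC mulfVK.
have : (1 + b * T + c * T ^+ 2) ^+ 2 = 1 + T ^+ 4.
  have -> : 1 + T ^+ 4 = (1 + b * T + c * T ^+ 2) ^+ 2
    + T * ((T ^+ 2 - s * T + n) * (e * T - (2 * b * c - e * s))
       + (- (e * s * n) + 2 * b * c * n - 2 * b)
       + (e * (s ^+ 2 - n) - 2 * b * c * s - (b ^+ 2 + 2 * c)) * T).
    by rewrite /e; ring.
  by rewrite eP eQ eT subrr mulr0 mul0r !addr0 mulr0 addr0.
(* From T = 0 follow b = 0 and s = 0, so t^2, and with it x^2 and y^2, are in K. *)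
move/quartic_add_points => T0.
have es : e * s = 2 * b * c by apply/eqP; rewrite eq_sym -subr_eq0 -eT T0 mulr0.
have b0 : b = 0.
  move/eqP: eP; rewrite es addNr sub0r oppr_eq0 mulf_eq0 (negPf two0) => /eqP
    //.
have s0 : s = 0.
  by move/eqP: es; rewrite b0 mulr0 mul0r mulf_eq0 (negPf e0) => /eqP.
have {}t2 : t ^+ 2 = f (- n) by rewrite t2 s0 rmorph0 mul0r sub0r rmorphN.
have {}qW : x ^+ 2 * f (1 - c * n) = 1.
  by rewrite -[RHS]qW b0 t2; ring.
have cn0 : f (1 - c * n) != 0 by apply: contra_eq_neq qW => ->;
  rewrite mulr0 eq_sym oner_neq0.
have x2 : x ^+ 2 = f (1 - c * n)^-1 by rewrite fmorphV -[LHS](mulfK cn0) qW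
  mul1r.
have [] := @fermat_sqr_K x y _ (- n / (1 - c * n)) qx qy xy x2.
- by rewrite yE exprMn t2 x2 -rmorphM.
- by constructor 1.
- by constructor 2.
Qed.

End QuadraticPoints.
End Curves.

(** * Quadratic points in coordinates *)

Lemma vline_scale (F : fieldType) (vT : vectType F) (k : F) (v : vT) :
  k != 0 -> <[k *: v]>%VS = <[v]>%VS.
Proof.
move=> k0; apply: subv_anti; rewrite -!memvE memvZ ?memv_line //=.
by rewrite -{1}[v](scalerK k0) memvZ ?memv_line.
Qed.

(** The abstract extension is replaced by a square root [d] in [algC], so that points over different
    base fields can be compared. *)
Definition quadratic_fermat_point (F : fieldType) (iota : {rmorphism F -> algC})
    (P : {vspace 'rV[algC]_3}) :=
  exists (D : F) (d : algC) (v : 'rV[algC]_3),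
    [/\ forall c, c ^+ 2 != D, d ^+ 2 = iota D & v != 0] /\
    [/\ v 0 0 ^+ 4 + v 0 1 ^+ 4 = v 0 2%:R ^+ 4,
        forall i, quadratic iota d (v 0 i) & P = <[v]>%VS].

(** Any z outside F generates L; completing the square in its quadratic equation yields d. *)
Lemma quadratic_generator (F : fieldType) (L : fieldExtType F) :
  (2 : F) != 0 -> \dim {:L} = 2%N ->
  exists (D : F) (d : L), [/\ forall c, c ^+ 2 != D, d ^+ 2 = D%:A &
    forall w : L, exists a b : F, w = a%:A + b%:A * d].
Proof.
move=> two0 dimL.
have [z zN1] : exists z : L, z \notin 1%VS.
  apply: contrapT => h; have : ({:L} <= 1%VS)%VS.
    by apply/subvP => w _; apply: contrapT => hw; apply: h; exists w;
      apply/negP.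
  by move/dimvS; rewrite dimL dimv1.
have full : (1 + <[z]> = {:L})%VS.
  have [le_dim eq_dim] := dimv_leqif_eq (addvSl 1 <[z]>%VS).
  rewrite dimv1 in le_dim eq_dim.
  apply/eqP; rewrite eqEdim subvf dimL /= ltn_neqAle eq_dim le_dim andbT.
  apply: contra zN1 => /eqP ->; apply: (subvP (addvSr 1 <[z]>%VS));
    exact: memv_line.
have gen (w : L) : exists a b : F, w = a%:A + b%:A * z.
  have : w \in (1 + <[z]>)%VS by rewrite full memvf.
  case/memv_addP => _ /vlineP[a ->] [_ /vlineP[b ->] ->].
  by exists a, b; rewrite -scalerAl mul1r.
have [a [b zz]] := gen (z ^+ 2).
pose h := b / 2; have bE : b = 2 * h by rewrite mulrC mulfVK.
pose d := z - h%:A; have zE : z = d + h%:A by rewrite subrK.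
have dd : d ^+ 2 = (a + h ^+ 2)%:A.
  by rewrite /d; move: zz; rewrite -!in_algE bE => zz; ring: zz.
exists (a + h ^+ 2), d; split=> // [c|w].
  apply/eqP => cD; have : (d - c%:A) * (d + c%:A) = 0.
    by rewrite -subr_sqr dd -cD -!in_algE rmorphXn subrr.
  move/eqP; rewrite mulf_eq0 subr_eq0 addr_eq0 => e; case/negP: zN1; rewrite zE.
  by case/orP: e => /eqP ->; rewrite ?rpredD ?rpredN ?memvZ ?mem1v.
have [a' [b' ->]] := gen w; exists (a' + b' * h), b'.
by rewrite zE -!in_algE; ring.
Qed.

Lemma quadratic_extension (F : fieldType) (iota : {rmorphism F -> algC})
    (D : F) (d : algC) :
  (forall c, c ^+ 2 != D) -> d ^+ 2 = iota D ->
  exists (L : fieldExtType F) (j : {rmorphism L -> algC}) (r : L),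
    [/\ forall c : F, j c%:A = iota c, \dim {:L} = 2%N & j r = d].
Proof.
move=> D_nonsqr d_sqr.
pose p : {poly F} := 'X^2 - D%:P.
have sp : size p = 3%N by rewrite size_XnsubC.
have pz0 : root (map_poly iota p) d.
  by rewrite /root rmorphB /= map_polyXn map_polyC /= !hornerE d_sqr subrr.
have irr : irreducible_poly p.
  apply: cubic_irreducible; rewrite ?sp // => x.
  by rewrite /root !hornerE subr_eq0.
exists (SubFieldExtType pz0 irr), (subfx_inj (iota := iota) (z := d) (p := p)),
  (subfx_root iota d p).
split.
- by move=> c; apply: subfx_inj_base => //; apply: irredp_neq0.
- by rewrite dimvf /dim /= sp.
- exact: subfx_inj_root pz0 (irredp_neq0 irr).
Qed.

Lemma Gamma2P (F : fieldType) (iota : {rmorphism F -> algC}) P :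
  (2 : F) != 0 -> Gamma2 iota P <-> quadratic_fermat_point iota P.
Proof.
move=> two0; split.
  case=> L [j [jE dimL [v [v0 vF ->]]]].
  have [D [d [D_nonsqr dd gen]]] := quadratic_generator two0 dimL.
  exists D, (j d), (map_mx j v); split.
    by split; rewrite ?map_mx_eq0 // -rmorphXn dd jE.
  split=> //; first by rewrite !mxE -!rmorphXn -rmorphD vF.
  move=> i; have [a [b e]] := gen (v 0 i).
  by exists a, b; rewrite mxE e rmorphD rmorphM !jE.
case=> D [d [v [[D_nonsqr d_sqr v0] [vF vq ->]]]].
have [L [j [r [jE dimL jr]]]] := quadratic_extension D_nonsqr d_sqr.
exists L, j; split=> //.
have [a /choice[b e]] := choice vq.
pose w : 'rV[L]_3 := \row_i ((a i)%:A + (b i)%:A * r).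
have wv : map_mx j w = v.
  by apply/rowP => i; rewrite !mxE rmorphD rmorphM !jE jr e.
exists w; split; rewrite ?wv //.
  by rewrite -(map_mx_eq0 j) wv.
by apply: (fmorph_inj j); rewrite rmorphD !rmorphXn; move: vF; rewrite -wv !mxE.
Qed.

(** * Coordinates in Q(i) and Q(sqrt(-7)) *)

Lemma quadratic_ratr_N1 (y : algC) : y ^+ 4 = 1 -> quadratic ratr 'i y.
Proof.
move=> y4; have : (y - 1) * (y + 1) * ((y - 'i) * (y + 'i)) = 0.
  have i2 := sqrCi algC; have -> : 0 = y ^+ 4 - 1 by rewrite y4 subrr.
  by ring: i2.
have two_Q (a b : rat) : quadratic ratr ('i : algC) (ratr a + ratr b * 'i) by
  exists a, b.
move/eqP; rewrite !mulf_eq0 !subr_eq0 !addr_eq0 -orbA => /or4P[] /eqP ->.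
- by have := two_Q 1 0; rewrite rmorph1 rmorph0 mul0r addr0.
- by have := two_Q (-1) 0; rewrite rmorphN1 rmorph0 mul0r addr0.
- by have := two_Q 0 1; rewrite rmorph1 rmorph0 mul1r add0r.
- by have := two_Q 0 (-1); rewrite rmorphN1 rmorph0 mulN1r add0r.
Qed.

Lemma quadratic_ratr_N7 (x y th s e : algC) :
  s ^+ 2 = 1 -> e ^+ 2 = 1 -> 2 * x = s + th -> 2 * y = e * (s - th) ->
  quadratic ratr th x /\ quadratic ratr th y.
Proof.
have pm1 (z : algC) : z ^+ 2 = 1 -> exists q : rat, z = ratr q.
  move=> /eqP; rewrite -subr_eq0 -[1](expr1n _ 2) subr_sqr mulf_eq0 subr_eq0
    addr_eq0.
  by case/orP => /eqP ->;
    [exists 1; rewrite rmorph1 | exists (-1); rewrite rmorphN1].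
have two0 : (2 : algC) != 0 by rewrite pnatr_eq0.
move=> /pm1[p ->] /pm1[q ->] hx hy; split.
  exists (p / 2), (1 / 2); apply: (mulfI two0); rewrite hx.
  by rewrite !fmorph_div rmorph1 rmorph_nat; field.
exists (q * p / 2), (- q / 2); apply: (mulfI two0); rewrite hy.
by rewrite !fmorph_div rmorphN rmorphM rmorph_nat; field.
Qed.

Lemma rat_sqr_neq_neg (n : nat) (c : rat) : c ^+ 2 != - n.+1%:R.
Proof.
by apply/eqP => h; have := sqr_ge0 c; rewrite h oppr_ge0 leNgt ltr0n.
Qed.

Theorem theorem1p1 (K : fieldExtType rat) (iota : {rmorphism K -> algC})
    (odd_deg : odd (\dim {:K}))
    (rank_E1 : ec_has_rank (4 : K) 0 0%N)
    (rank_E2 : ec_has_rank (- 4 : K) 0 0%N) :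
  Gamma2 iota = Gamma2 (ratr : {rmorphism rat -> algC}).
Proof.
have two0 := natr_neq0 K 1; have two0Q : (2 : rat) != 0 by [].
apply/seteqP; split=> P; last first.
  case/(Gamma2P _ _ two0Q) => D [d [v [[D_nonsqr d_sqr v0] [vF vq ->]]]].
  apply/(Gamma2P _ _ two0).
  have iotaQ q : iota q%:A = ratr q by rewrite
    -(fmorph_eq_rat (iota \o in_alg K)).
  (* The same [D] and [d] serve over K: by [rat_sqrt], [D] stays a nonsquare there. *)
  exists D%:A, d, v; split; last first.
    split=> // i; have [a [b ->]] := vq i.
    by exists a%:A, b%:A; rewrite !iotaQ.
  split=> //; last by rewrite iotaQ.
  move=> c; apply/eqP => /(rat_sqrt odd_deg)[q _ Dq].
  by have := D_nonsqr q; rewrite Dq eqxx.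
case/(Gamma2P _ _ two0) => D [d [v [[D_nonsqr d_sqr v0] [vF vq ->]]]].
apply/(Gamma2P _ _ two0Q).
(* At infinity [fermat_infinity], used for both orders of the coordinates, would make v vanish. *)
have z0 : v 0 2%:R != 0.
  apply: contraNneq v0 => z0; rewrite z0 expr0n in vF.
  have y0 := fermat_infinity odd_deg d_sqr D_nonsqr (vq _) (vq _) vF.
  rewrite addrC in vF.
  have x0 := fermat_infinity odd_deg d_sqr D_nonsqr (vq _) (vq _) vF.
  apply/eqP/rowP => i; rewrite mxE.
  by case: i => [[|[|[|//]]] lt_i];
    [rewrite -[RHS]x0|rewrite -[RHS]y0|rewrite -[RHS]z0]; congr (v _ _);
      apply: val_inj.
set z := v 0 2%:R in vF z0; pose x := v 0 0 / z; pose y := v 0 1 / z.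
have xy : x ^+ 4 + y ^+ 4 = 1 by rewrite !expr_div_n -mulrDl vF mulfV //
  expf_neq0.
have qx : quadratic iota d x by apply: (quadM d_sqr) => //;
  apply: (quadV d_sqr D_nonsqr); apply: vq.
have qy : quadratic iota d y by apply: (quadM d_sqr) => //;
  apply: (quadV d_sqr D_nonsqr); apply: vq.
(* After scaling the last coordinate to 1, it suffices that x and y lie in one quadratic field over
   Q. *)
suff [D' [d' [D'_nonsqr d'_sqr qx' qy']]] : exists (D' : rat) (d' : algC),
    [/\ forall c, c ^+ 2 != D', d' ^+ 2 = ratr D',
      quadratic ratr d' x & quadratic ratr d' y].
  exists D', d', (z^-1 *: v); split; first by split;
    rewrite // scaler_eq0 invr_eq0 (negPf z0).
  split; rewrite ?vline_scale ?invr_eq0 //.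
    rewrite !mxE -/z -[_ * v 0 0]mulrC -/x -[_ * v 0 1]mulrC -/y mulVf //
      expr1n.
    exact: xy.
  move=> i; rewrite mxE mulrC.
  case: i => [[|[|[|//]]] lt_i].
  - by rewrite (_ : v _ _ / z = x) //; congr (v _ _ / z); apply: val_inj.
  - by rewrite (_ : v _ _ / z = y) //; congr (v _ _ / z); apply: val_inj.
  - rewrite (_ : v _ _ = z) ?mulfV //; last by congr (v _ _); apply: val_inj.
    by exists 1, 0; rewrite rmorph0 mul0r addr0 rmorph1.
have zeroQ d' : quadratic ratr d' 0 by exists 0, 0; rewrite rmorph0 mul0r addr0.
(* If x or y is 0, the other is a fourth root of unity, hence in Q(i); the remaining points are over
   Q(sqrt(-7)). *)
case: (fermat_quad_points odd_deg rank_E1 rank_E2 d_sqr D_nonsqr qx qy xy).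
- move=> x0; exists (-1), 'i; split; rewrite ?x0 //.
  + exact: (rat_sqr_neq_neg 0).
  + by rewrite sqrCi rmorphN1.
  + by apply: quadratic_ratr_N1; rewrite -xy x0 expr0n add0r.
- move=> y0; exists (-1), 'i; split; rewrite ?y0 //.
  + exact: (rat_sqr_neq_neg 0).
  + by rewrite sqrCi rmorphN1.
  + by apply: quadratic_ratr_N1; rewrite -xy y0 expr0n addr0.
- move=> [th [s [e [th2 s2 e2 hx hy]]]]; exists (-7), th.
  have [qx' qy'] := quadratic_ratr_N7 s2 e2 hx hy; split=> //.
    exact: (rat_sqr_neq_neg 6).
  by rewrite th2 rmorphN rmorph_nat.
Qed.
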